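(* Let $n\ge2$ and $p,q\in\Delta_n$, with associated solvmanifolds $\Gamma_p\backslash G_p$ and $\Gamma_q\backslash G_q$. Then $\Gamma_p\backslash G_p$ and $\Gamma_q\backslash G_q$ are diffeomorphic if and only if $q=p$ or $q=p^*$, where $p^*(x)=(-1)^nx^np(x^{-1})$.
   Context: For $n\ge2$, $\Delta_n$ is the set of monic polynomials $p\in\mathbb{Z}[x]$ of degree $n$ having $n$ different real roots, all of them positive, and with $p(0)=(-1)^n$. For $p\in\Delta_n$ with roots $r_1<\dots<r_n$ let $X_p=\operatorname{diag}(\log r_1,\dots,\log r_n)$ and $A_p=0_3\oplus X_p^{\oplus4}\in\mathfrak{sl}(4n+3,\mathbb{R})$ (block diagonal, $0_3$ the $3\times 3$ zero matrix, four copies of $X_p$). $G_p=\mathbb{R}\ltimes_\varphi\mathbb{R}^{4n+3}$ is the simply connected Lie group with $\varphi(t)=e^{tA_p}$ and product $(t,v)(s,w)=(t+s,v+\varphi(t)w)$. Let $C_p\in\operatorname{SL}(n,\mathbb{Z})$ be the companion matrix of $p$ and $\widetilde C_p=I_3\oplus C_p^{\oplus4}$. Then $\varphi(1)$ is conjugate to $\widetilde C_p$; choose $Q_p\in\operatorname{GL}(4n+3,\mathbb{R})$ with $Q_p^{-1}\varphi(1)Q_p=\widetilde C_p$ and set $\Gamma_p=\mathbb{Z}\ltimes_{\varphi(1)}Q_p\mathbb{Z}^{4n+3}\subset G_p$, a lattice in $G_p$ (discrete subgroup with compact quotient), isomorphic to $\mathbb{Z}\ltimes_{\widetilde C_p}\mathbb{Z}^{4n+3}$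 independently of the choice of $Q_p$. *)

(* Defs.v *)
From HB Require Import structures.
From mathcomp Require Import all_boot all_order all_algebra generic_quotient.
From mathcomp Require Import polyrcf.
From mathcomp Require Import all_classical all_reals all_analysis.

Set Implicit Arguments.
Unset Strict Implicit.
Unset Printing Implicit Defensive.

Import Order.TTheory GRing.Theory Num.Theory.
Import numFieldNormedType.Exports.

Local Open Scope classical_set_scope.
Local Open Scope ring_scope.

Section SmoothMaps.
Context {R : realType}.

(* Only used with U open and V, W finite dimensional: f is C^k on U when all
   its iterated directional derivatives of order at most k exist and are
   continuous at every point of U. *)
Fixpoint Ck (V W : normedModType R) (k : nat) (U : set V) (f : V -> W) : Prop :=
  (forall x, U x -> {for x, continuous f}) /\
  if k is k'.+1 then
    forall v, (forall x, U x -> derivable f x v) /\ Ck k' U ('D_v f)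
  else True.

Definition smooth_on (V W : normedModType R) (U : set V) (f : V -> W) : Prop :=
  forall k, Ck k U f.

(* A homeomorphism from an open subset of M onto an open subset of V.  The
   values of chart_fun off chart_dom, and those of chart_inv off the image of
   chart_dom, are irrelevant. *)
Record chart (V : normedModType R) (M : topologicalType) := Chart {
  chart_dom : set M;
  chart_fun :> M -> V;
  chart_inv : V -> M;
  chart_open : open chart_dom;
  chart_open_img : open (chart_fun @` chart_dom);
  chart_funK : {in chart_dom, cancel chart_fun chart_inv};
  chart_continuous : {within chart_dom, continuous chart_fun};
  chart_inv_continuous :
    {within chart_fun @` chart_dom, continuous chart_inv} }.

(* A smooth structure on M is given by an atlas A : set (chart V M).  Every
   point x has charts a at x and b at f x, with f mapping the domain of a into
   that of b, in which f is smooth. *)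
Definition smooth_map (V W : normedModType R) (M N : topologicalType)
    (A : set (chart V M)) (B : set (chart W N)) (f : M -> N) : Prop :=
  forall x, exists (a : chart V M) (b : chart W N),
    [/\ A a, B b, chart_dom a x,
        f @` chart_dom a `<=` chart_dom b &
        smooth_on (a @` chart_dom a) (b \o f \o chart_inv a)].

Definition diffeomorphic (V W : normedModType R) (M N : topologicalType)
    (A : set (chart V M)) (B : set (chart W N)) : Prop :=
  exists (f : M -> N) (g : N -> M),
    [/\ cancel f g, cancel g f, smooth_map A B f & smooth_map B A g].

End SmoothMaps.

Section RightCosets.
Local Open Scope quotient_scope.
Context {R : realType} {V : normedModType R}.
Variables (mul : V -> V -> V) (Gam : set V).

Definition rcoset_set (g : V) : set V := [set mul c g | c in Gam].

Definition same_rcoset : rel V :=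
  fun g h => `[< rcoset_set g = rcoset_set h >].

Lemma same_rcoset_equiv : equiv_class_of same_rcoset.
Proof.
split=> [g|g h|h g k]; first exact/asboolP.
- by apply/idP/idP => /asboolP e; apply/asboolP.
- by move=> /asboolP gh /asboolP hk; apply/asboolP; rewrite gh.
Qed.
Canonical same_rcoset_equiv_rel := EquivRelPack same_rcoset_equiv.

(* The space Gam \ V of cosets Gam g, with the quotient topology. *)
Definition rcoset_space := quotient_topology {eq_quot same_rcoset}.

(* For Gam discrete, the projection V -> Gam \ V is a covering map; the smooth
   structure of Gam \ V is the one for which it is a local diffeomorphism, so
   its charts are the local sections of the projection. *)
Definition quotient_atlas : set (chart V rcoset_space) :=
  [set c | {in chart_dom c, cancel c \pi_rcoset_space}].

End RightCosets.
Arguments quotient_atlas {R V} mul Gam _.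

(* 4 n + 3, in the form adapted to iterated block matrices *)
Notation solv_dim n := (3 + (n + (n + (n + n))))%N.

Definition dsum4 (S : pzRingType) (n : nat) (E : 'M[S]_3) (X : 'M[S]_n) :
    'M[S]_(solv_dim n) :=
  block_mx E 0 0 (block_mx X 0 0 (block_mx X 0 0 (block_mx X 0 0 X))).

(* For size p <= n.+1, this is (-1)^n x^n p(1/x). *)
Definition star (n : nat) (p : {poly int}) : {poly int} :=
  (-1) ^+ n *: \poly_(i < n.+1) p`_(n - i).

Section Solvmanifolds.
Context {R : realType}.

Definition expmx (m : nat) (A : 'M[R]_m) : 'M[R]_m :=
  lim (series (fun k : nat => k`!%:R^-1 *: A ^+ k) @ \oo).

(* rootsR lists the distinct real roots of a nonzero polynomial in increasing
   order. *)
Definition real_roots (p : {poly int}) : seq R := rootsR (map_poly intr p).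

Variable n : nat.

Definition Delta (p : {poly int}) : Prop :=
  [/\ p \is monic, size p = n.+1, size (real_roots p) = n,
      {in real_roots p, forall r, 0 < r} & p.[0] = (-1) ^+ n].

Definition solv_mx (p : {poly int}) : 'M[R]_(solv_dim n) :=
  dsum4 0 (diag_mx (\row_(i < n) ln (real_roots p)`_i)).

Definition solv_phi (p : {poly int}) (t : R) : 'M[R]_(solv_dim n) :=
  expmx (t *: solv_mx p).

Definition solv_group : normedModType R := (R^o * 'cV[R]_(solv_dim n))%type.

Definition solv_mul (p : {poly int}) (g h : solv_group) : solv_group :=
  (g.1 + h.1, g.2 + solv_phi p g.1 *m h.2).

(* companionmx p has dimension (size p).-1, which is n for p in Delta *)
Definition companion (p : {poly int}) : 'M[int]_n :=
  conform_mx 0 (companionmx p).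

Definition conjugates (p : {poly int}) (Q : 'M[R]_(solv_dim n)) : Prop :=
  Q \in unitmx /\
  invmx Q *m solv_phi p 1 *m Q = map_mx intr (dsum4 1%:M (companion p)).

Definition solv_lattice (Q : 'M[R]_(solv_dim n)) : set solv_group :=
  [set g | exists (k : int) (z : 'cV[int]_(solv_dim n)),
     g = (k%:~R, Q *m map_mx intr z)].

(* The solvmanifold Gamma_p \ G_p, as an atlas on the coset space *)
Definition solvmanifold (p : {poly int}) (Q : 'M[R]_(solv_dim n)) :=
  quotient_atlas (solv_mul p) (solv_lattice Q).

End Solvmanifolds.
Arguments Delta R n p : clear implicits.
Arguments solvmanifold {R n} p Q _.

(* Main.v *)
(* A diffeomorphism between the two quotients lifts, G_p being simply connected,
   to a homeomorphism G_p -> G_q that intertwines the left translations by the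
   lattices, and hence induces an isomorphism Gamma_p -> Gamma_q.  Its
   restriction to the fibre Z^(4n+3) is well defined, because that subgroup
   consists of the elements of Gamma_p commuting with all of their own
   commutators; it is given by an invertible matrix S such that
   S phi_p(1) = phi_q(k) S with k = 1 or k = -1.  Both sides have the same
   characteristic polynomial, which is (x - 1)^3 p^4 on the left and
   (x - 1)^3 r^4 on the right, with r = q if k = 1 and r = q^* if k = -1.

   Conversely, since companion matrices of p and p^* are conjugate to each
   other's inverses over the integers, such an S exists when q = p or q = p^*;
   since exp is injective on the diagonal of X_p, it intertwines all of phi_p
   with phi_q, so (t, v) |-> (k t, S v) is an isomorphism G_p -> G_q mapping
   Gamma_p onto Gamma_q. *)

Require Import Defs.
From HB Require Import structures.
From mathcomp Require Import all_boot all_order all_algebra generic_quotient.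
From mathcomp Require Import polyrcf.
From mathcomp Require Import all_classical all_reals all_analysis.
From mathcomp Require Import zify lra.

Set Implicit Arguments.
Unset Strict Implicit.
Unset Printing Implicit Defensive.

Import Order.TTheory GRing.Theory Num.Theory.
Import numFieldNormedType.Exports.

Local Open Scope classical_set_scope.
Local Open Scope ring_scope.

(** * Connectedness of the unit interval *)

(** Connectedness of [0, 1] as an induction principle: close to the supremum of the points where [P]
    holds there is such a point, and the local hypothesis carries [P] from it past the supremum,
    which is absurd, or to 1. *)
Lemma unit_interval_ind (R : realType) (P : R -> Prop) :
  P 0 ->
  (forall s, 0 <= s <= 1 -> exists2 d, 0 < d &
     forall t t', 0 <= t <= 1 -> 0 <= t' <= 1 ->
       `|t - s| < d -> `|t' - s| < d -> P t -> P t') ->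
  P 1.
Proof.
move=> P0 Ploc; pose A := [set t | 0 <= t <= 1 /\ P t].
have A0 : A 0 by split; rewrite // lexx ler01.
have supA : has_sup A.
  by split; [exists 0 | exists 1 => t [/andP[]]].
have s0 : 0 <= sup A by apply: ub_le_sup => //; case: supA.
have s1 : sup A <= 1.
  by apply: ge_sup; [exists 0 | move=> t [/andP[]]].
have [|d d0 Pd] := Ploc (sup A); first by rewrite s0 s1.
have [t [t01 Pt] tA] := sup_adherent d0 supA.
have tS : t <= sup A by apply: ub_le_sup; [case: supA | split].
have td : `|t - sup A| < d by rewrite ler0_norm; lra.
have [s1d|s1d] := leP (sup A + d / 2) 1.
  have : A (sup A + d / 2).
    have d2 : 0 <= sup A + d / 2 <= 1.
      by rewrite s1d addr_ge0 // divr_ge0 // ltW.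
    split=> //; apply: (Pd t) => //.
    by rewrite addrAC subrr add0r ger0_norm; lra.
  move=> As; have : sup A + d / 2 <= sup A.
    by apply: ub_le_sup => //; case: supA.
  lra.
by apply: (Pd t) => //; [rewrite ler01 lexx | rewrite ger0_norm; lra].
Qed.

(** * Group laws and projections to coset spaces *)

(** The identity is fixed to be the origin of [V], which is also the base point used for lifting. *)
Record group_law (V : zmodType) (mul : V -> V -> V) (inv : V -> V) := GroupLaw {
  lawA : associative mul;
  law0l : left_id 0 mul;
  lawVl : forall x, mul (inv x) x = 0 }.

Section GroupLaw.
Context {V : zmodType} {mul : V -> V -> V} {inv : V -> V}.
Hypothesis G : group_law mul inv.

Lemma lawKl x : cancel (mul x) (mul (inv x)).
Proof. by move=> y; rewrite (lawA G) (lawVl G) (law0l G). Qed.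

Lemma law_injr x : injective (mul x).
Proof. exact: can_inj (lawKl x). Qed.

Lemma law0r : right_id 0 mul.
Proof.
move=> x; apply: (@law_injr (inv x)).
by rewrite (lawA G) (lawVl G) (law0l G).
Qed.

Lemma lawVr x : mul x (inv x) = 0.
Proof.
by apply: (@law_injr (inv x)); rewrite (lawA G) (lawVl G) (law0l G) law0r.
Qed.

Lemma lawVKl x : cancel (mul (inv x)) (mul x).
Proof. by move=> y; rewrite (lawA G) lawVr (law0l G). Qed.

Lemma law_injl x : injective (mul^~ x).
Proof.
move=> y z /(congr1 (mul^~ (inv x))) /=.
by rewrite -!(lawA G) lawVr !law0r.
Qed.

End GroupLaw.

(** Left translations by elements of such a [Gam] are homeomorphisms: they are the deck
    transformations of the projection to the coset space. *)
Record translation_group (V : topologicalZmodType) (mul : V -> V -> V)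
    (inv : V -> V) (Gam : set V) := TranslationGroup {
  trans_law : group_law mul inv;
  trans0 : Gam 0;
  transM : forall x y, Gam x -> Gam y -> Gam (mul x y);
  transV : forall x, Gam x -> Gam (inv x);
  trans_continuous : forall x, Gam x -> continuous (mul x) }.

Section Projection.
Local Open Scope quotient_scope.
Context {R : realType} {V : normedModType R}.

Definition rproj (mul : V -> V -> V) (Gam : set V) (x : V) :
  rcoset_space mul Gam := \pi_(rcoset_space mul Gam) x.

Context (mul : V -> V -> V) (inv : V -> V) (Gam : set V).
Local Notation M := (rcoset_space mul Gam).
Local Notation pr := (rproj mul Gam).

Lemma rprojK (z : M) : pr (repr z) = z.
Proof. exact: reprK. Qed.

Lemma rproj_continuous : continuous pr.
Proof. exact: pi_continuous. Qed.

Lemma rproj_open (U : set M) : open (pr @^-1` U) -> open U.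
Proof. by []. Qed.

Hypothesis G : translation_group mul inv Gam.
Let L := trans_law G.

Lemma rprojP x y : pr x = pr y <-> exists2 c, Gam c & y = mul c x.
Proof.
have e : (pr x = pr y) <-> rcoset_set mul Gam x = rcoset_set mul Gam y.
  have P := @eqmodP V (same_rcoset_equiv_rel mul Gam) x y.
  by split=> [/P/asboolP|exy] //; apply/P/asboolP.
rewrite e; split=> [exy|[c Gc ->]].
  have : rcoset_set mul Gam x y.
    by rewrite exy; exists 0; [exact: trans0 G | exact: (law0l L)].
  by case=> c Gc <-; exists c.
apply/seteqP; split=> _ [d Gd <-].
  exists (mul d (inv c)); first by apply: (transM G) => //; apply: (transV G).
  by rewrite (lawA L) -(lawA L d) (lawVl L) (law0r L).
by exists (mul d c); [exact: (transM G) | rewrite (lawA L)].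
Qed.

Lemma rprojM c x : Gam c -> pr (mul c x) = pr x.
Proof. by move=> Gc; apply/esym/rprojP; exists c. Qed.

End Projection.

(** * Lifting along the projection to a coset space *)

Section Lifting.
Context {R : realType} {V E : normedModType R}.
Context (mul : V -> V -> V) (inv : V -> V) (Gam : set V).
Local Notation M := (rcoset_space mul Gam).
Local Notation pr := (rproj mul Gam).
Hypothesis G : translation_group mul inv Gam.
Let L := trans_law G.
(** A local section of the projection, together with its translates by [Gam], takes the place of an
    evenly covered neighbourhood. *)
Hypothesis atlas_cover :
  forall z : M, exists2 c, quotient_atlas mul Gam c & chart_dom c z.

(** Being a lift is made a condition at one point, so that partial lifts can be represented by total
    functions and glued. *)
Definition lift_at (h : E -> M) (F : E -> V) x :=
  {for x, continuous F} /\ \forall y \near x, pr (F y) = h y.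

Lemma lift_atE h F x : lift_at h F x -> pr (F x) = h x.
Proof. by case=> _ /nbhs_singleton. Qed.

Lemma lift_at_near h F F' x :
  lift_at h F x -> (\forall y \near x, F' y = F y) -> lift_at h F' x.
Proof.
move=> [Fx hF] FF'; split; last by near=> y; rewrite (near FF' y)// (near hF y).
rewrite /prop_for/continuous_at (nbhs_singleton FF').
apply: cvg_trans Fx; apply: near_eq_cvg.
by near=> y; apply/esym; near: y.
Unshelve. all: by end_near. Qed.

Lemma near_translate c (F : E -> V) x : Gam c -> {for x, continuous F} ->
  {for x, continuous (mul c \o F)}.
Proof.
by move=> Gc Fx; apply: continuous_comp => //; apply: (trans_continuous G).
Qed.

(** A lift stays on one sheet: by continuity the translate of [F y] by [inv g] remains in the open
    image of the chart [c], where the projection is inverted by [c]. *)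
Lemma lift_at_chart h F x c g : quotient_atlas mul Gam c ->
    chart_dom c (h x) -> Gam g -> F x = mul g (c (h x)) -> lift_at h F x ->
  \forall y \near x, F y = mul g (c (h y)).
Proof.
move=> cA cx Gg Fx LF; have [Fc hF] := LF.
have oU := chart_open_img c; have Gig := transV G Gg.
have : \forall y \near x, (c @` chart_dom c) (mul (inv g) (F y)).
  apply: (near_translate Gig Fc); apply: open_nbhs_nbhs; split=> //=.
  by rewrite Fx (lawKl L); exists (h x).
move=> H; near=> y.
have [z cz e] : (c @` chart_dom c) (mul (inv g) (F y)) by near: y.
have hz : h y = z.
  have <- : pr (F y) = h y by near: y.
  rewrite -(rprojM G _ Gig) -e.
  by apply: cA; rewrite inE.
by rewrite hz e (lawVKl L).
Unshelve. all: by end_near. Qed.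

Lemma lift_at_chart_coef h F x c : quotient_atlas mul Gam c ->
  chart_dom c (h x) -> lift_at h F x ->
  exists2 g, Gam g & F x = mul g (c (h x)).
Proof.
move=> cA cx /lift_atE hx; apply/(rprojP G); rewrite hx.
by apply: cA; rewrite inE.
Qed.

(** Near [x] both lifts are translates of the same section by constants [g] and [g'], so they agree
    at a nearby point exactly when [g = g']. Thus the set of agreement is open and closed. *)
Lemma lift_at_eq h F F' x : lift_at h F x -> lift_at h F' x ->
  \forall y \near x, F y = F' y <-> F x = F' x.
Proof.
move=> LF LF'; have [c cA cx] := atlas_cover (h x).
have [g Gg Fx] := lift_at_chart_coef cA cx LF.
have [g' Gg' Fx'] := lift_at_chart_coef cA cx LF'.
have H := lift_at_chart cA cx Gg Fx LF.
have H' := lift_at_chart cA cx Gg' Fx' LF'.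
near=> y.
have -> : F y = mul g (c (h y)) by near: y.
have -> : F' y = mul g' (c (h y)) by near: y.
by rewrite Fx Fx'; split=> /(law_injl L) ->.
Unshelve. all: by end_near. Qed.

Lemma lift_at_translate h F x c : Gam c -> lift_at h F x ->
  lift_at h (mul c \o F) x.
Proof.
move=> Gc [Fx hF]; split; first exact: near_translate.
by near=> y; rewrite /= (rprojM G)//; near: y.
Unshelve. all: by end_near. Qed.

Definition segm (a b : E) (s : R) : E := a + s *: (b - a).

Lemma segm_near a b s (P : E -> Prop) : (\forall y \near segm a b s, P y) ->
  exists2 d, 0 < d & forall t, `|t - s| < d -> P (segm a b t).
Proof.
move=> Ps; have : \forall t \near s, P (segm a b t).
  have : {for s, continuous (segm a b)}.
    apply: (@continuousD _ _ _ (cst a)); first exact: cst_continuous.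
    by apply: continuousZr_tmp; exact: cvg_id.
  by apply.
move=> /nbhs_ballP[d d0 dP]; exists d => // t td.
by apply: dP; rewrite /ball/= distrC.
Qed.

(** Agreement of two lifts is locally constant along the segment, which is connected. *)
Lemma lift_unique h F F' a b :
  (forall s, 0 <= s <= 1 -> lift_at h F (segm a b s)) ->
  (forall s, 0 <= s <= 1 -> lift_at h F' (segm a b s)) ->
  F a = F' a -> F b = F' b.
Proof.
move=> LF LF' Fa.
have -> : b = segm a b 1 by rewrite /segm scale1r addrC subrK.
pattern (1 : R); apply: unit_interval_ind.
  by rewrite /segm scale0r addr0.
move=> s s01; have [d d0 dP] := segm_near (lift_at_eq (LF s s01) (LF' s s01)).
by exists d => // t t' _ _ td td' Ft; apply/(dP t') => //; apply/(dP t).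
Qed.

Lemma segm_dist x y u w r e : 0 <= r <= 1 ->
  `|x - u| < e -> `|y - w| < e -> `|segm x y r - segm u w r| < e.
Proof.
move=> /andP[r0 r1] xu yw.
have -> : segm x y r - segm u w r = (1 - r) *: (x - u) + r *: (y - w).
  have e1 : y - x - (w - u) = y - w - (x - u).
    by rewrite opprD addrACA -opprD.
  rewrite /segm opprD addrACA -scalerBr e1 scalerBl scale1r scalerBr.
  by rewrite [r *: _ - _]addrC addrA.
apply: (le_lt_trans (ler_normD _ _)).
rewrite !normrZ ger0_norm ?subr_ge0// ger0_norm//.
pose m := Num.max `|x - u| `|y - w|.
apply: (@le_lt_trans _ _ ((1 - r) * m + r * m)).
  by rewrite lerD// ler_wpM2l ?subr_ge0// le_max lexx ?orbT.
by rewrite -mulrDl subrK mul1r gt_max xu yw.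
Qed.

(** A neighbourhood of the segment from 0 to [t *: v]. It is open and convex, so that lifts on it
    can be compared along segments. *)
Definition tube (v : E) (t e : R) : set E :=
  [set x | exists2 s, 0 <= s <= t & `|x - s *: v| < e].

Lemma segmxx a s : segm a a s = a.
Proof. by rewrite /segm subrr scaler0 addr0. Qed.

Lemma tube_segm v t e x y r : 0 <= r <= 1 ->
  tube v t e x -> tube v t e y -> tube v t e (segm x y r).
Proof.
move=> r01 [s s01 xs] [s' s01' ys]; exists (s + r * (s' - s)).
  move: r01 s01 s01' => /andP[r0 r1] /andP[s0 st] /andP[s'0 s't].
  apply/andP; split; nra.
have -> : (s + r * (s' - s)) *: v = segm (s *: v) (s' *: v) r.
  by rewrite /segm -scalerBl scalerA scalerDl.
exact: segm_dist.
Qed.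

Lemma norm_lt_near (a x : E) e :
  `|x - a| < e -> \forall y \near x, `|y - a| < e.
Proof.
have : {for x, continuous (fun y => `|y - a|)}.
  apply: (@continuous_comp _ _ _ (fun y => y - a) (@Num.norm _ E)).
    by apply: cvgB; [exact: cvg_id | exact: cvg_cst].
  exact: norm_continuous.
by move=> /cvgr_lt; apply.
Qed.

Lemma tube_near v t e x : tube v t e x -> \forall y \near x, tube v t e y.
Proof.
move=> [s s01 xs].
by have := norm_lt_near xs; apply: filterS => y ys; exists s.
Qed.

(** Induction on the length [t] of the tube: a lift on a tube ending near [s *: v] is continued
    through a chart around [h (s *: v)]. The radius may shrink at each extension. *)
Lemma tube_lift h g0 v : continuous h -> pr g0 = h 0 ->
  exists2 e, 0 < e & exists2 F, F 0 = g0 &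
    forall x, tube v 1 e x -> lift_at h F x.
Proof.
move=> hc g0h.
pose P t := exists2 e, 0 < e & exists2 F, F 0 = g0 &
    forall x, tube v t e x -> lift_at h F x.
have chart_near x : exists2 c, quotient_atlas mul Gam c &
    exists2 d, 0 < d & forall y, `|y - x| < d -> chart_dom c (h y).
  have [c cA cx] := atlas_cover (h x).
  exists c => //.
  have : \forall y \near x, chart_dom c (h y).
    by apply: (hc x); apply: open_nbhs_nbhs; split=> //; exact: chart_open.
  move=> /nbhs_normP[d /= d0 dP]; exists d => // y yx.
  by apply: dP; rewrite /= distrC.
have chart_lift c g x : quotient_atlas mul Gam c -> Gam g ->
    chart_dom c (h x) -> lift_at h (fun y => mul g (c (h y))) x.
  move=> cA Gg cx; apply: (@lift_at_translate h (c \o h)) => //; split.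
    apply: continuous_comp; first exact: hc.
    have := @chart_continuous _ _ _ c.
    rewrite continuous_open_subspace; last exact: chart_open.
    by apply; rewrite inE.
  have : \forall y \near x, chart_dom c (h y).
    by apply: (hc x); apply: open_nbhs_nbhs; split=> //; exact: chart_open.
  by apply: filterS => y cy; apply: cA; rewrite inE.
suff : P 1 by [].
apply: unit_interval_ind.
  have [c cA [d d0 cd]] := chart_near 0.
  have c0 : chart_dom c (h 0) by apply: cd; rewrite subrr normr0.
  have [g Gg e0] : exists2 g, Gam g & g0 = mul g (c (h 0)).
    by apply/(rprojP G); rewrite g0h; apply: cA; rewrite inE.
  exists d => //; exists (fun y => mul g (c (h y))) => // x [s].
  move=> s0; have -> : s = 0 by apply/eqP; rewrite eq_le andbC.
  by rewrite scale0r => /cd cx; apply: chart_lift.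
move=> s s01; have [c cA [d d0 cd]] := chart_near (s *: v).
(* The summand 1 keeps [m] positive when [v] is 0. *)
pose m := 1 + `|v|; have m0 : 0 < m by rewrite ltr_pwDl.
exists (d / 2 / m); first by rewrite !divr_gt0.
have near_s r : `|r - s| < d / 2 / m -> `|r *: v - s *: v| < d / 2.
  rewrite ltr_pdivlMr// -scalerBl normrZ; apply: le_lt_trans.
  by rewrite ler_wpM2l// /m lerDr.
move=> t t' /andP[t0 t1] /andP[t0' t1'] ts ts' [e e0 [F F0 Fl]].
have tt : tube v t e (t *: v).
  by exists t; rewrite ?t0 ?lexx// subrr normr0.
have ct : chart_dom c (h (t *: v)).
  by apply: cd; apply: (lt_trans (near_s _ ts)); lra.
have [g Gg Ft] := lift_at_chart_coef cA ct (Fl _ tt).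
(* The sheet on which the old lift lies at the end [t *: v] of its tube. *)
pose L' y := mul g (c (h y)).
have L'l x : `|x - s *: v| < d -> lift_at h L' x.
  by move=> /cd cx; apply: chart_lift.
(* The old tube and the ball around [s *: v] are both convex and contain [t *: v], so uniqueness
   applies along the segment from [t *: v] to [x]. *)
have FL x : tube v t e x -> `|x - s *: v| < d -> F x = L' x.
  move=> tx xs; apply: (@lift_unique h F L' (t *: v)) => // r r01.
    by apply: Fl; apply: tube_segm.
  apply: L'l; rewrite -[s *: v](segmxx _ r); apply: segm_dist => //.
  by apply: (lt_trans (near_s _ ts)); lra.
exists (Num.min e (d / 2)); first by rewrite lt_min e0 divr_gt0.
exists (fun x => if `[< tube v t e x >] then F x else L' x).
  case: asboolP => // [[]]; exists 0; first by rewrite lexx.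
  by rewrite scale0r subrr normr0.
have glue1 x : tube v t e x ->
    lift_at h (fun x => if `[< tube v t e x >] then F x else L' x) x.
  move=> tx; apply: (lift_at_near (Fl x tx)).
  by apply: filterS (tube_near tx) => y ty; case: asboolP.
move=> x [r /andP[r0 rt]]; rewrite lt_min => /andP[xe xd].
have [rt'|rt'] := leP r t.
  by apply: glue1; exists r; rewrite ?r0.
(* Here [r] lies between [t] and [t'], both of which are close to [s]. *)
have rs : `|r - s| < d / 2 / m.
  by move: ts ts'; rewrite !ltr_norml; lra.
have xs : `|x - s *: v| < d.
  rewrite -(subrK (r *: v) x) -addrA; apply: (le_lt_trans (ler_normD _ _)).
  have := near_s _ rs; lra.
have := L'l x xs => /lift_at_near; apply.
apply: filterS (norm_lt_near xs) => y ys; case: asboolP => // ty; exact: FL.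
Qed.

End Lifting.

Section GlobalLift.
Context {R : realType} {V E : normedModType R}.
Context (mul : V -> V -> V) (inv : V -> V) (Gam : set V).
Local Notation M := (rcoset_space mul Gam).
Local Notation pr := (rproj mul Gam).
Hypothesis G : translation_group mul inv Gam.
Hypothesis atlas_cover :
  forall z : M, exists2 c, quotient_atlas mul Gam c & chart_dom c z.

(** Contractibility of [E] along rays replaces simple connectedness: the value at [v] is that of a
    lift along the segment from 0 to [v], taken on a whole tube around it. *)
Lemma lift_global (h : E -> M) g0 : continuous h -> pr g0 = h 0 ->
  exists2 F, F 0 = g0 & forall x, lift_at h F x.
Proof.
move=> hc g0h.
have /choice[F HF] v : exists F, F 0 = g0 /\
    exists2 e, 0 < e & forall x, tube v 1 e x -> lift_at h F x.
  have [e e0 [F F0 Fl]] := tube_lift G atlas_cover v hc g0h.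
  by exists F; split=> //; exists e.
exists (fun v => F v v); first by case: (HF 0).
move=> v; have [F0 [e e0 Fl]] := HF v.
have tv : tube v 1 e v by exists 1; rewrite ?ler01 ?lexx// scale1r subrr normr0.
apply: (lift_at_near (Fl v tv)).
(* The segment from 0 to [w] lies in the tube of [v] as well as in its own, so the two lifts agree
   at [w]. Hence the diagonal function coincides near [v] with the single lift [F v]. *)
apply: filterS (tube_near tv) => w tw.
have [F0' [e' e0' Fl']] := HF w.
apply: (lift_unique G atlas_cover (h := h) (a := 0));
  rewrite ?F0' ?F0// => s s01.
- apply: Fl'; apply: tube_segm => //.
    by exists 0; rewrite ?lexx ?ler01// scale0r subrr normr0.
  by exists 1; rewrite ?ler01 ?lexx// scale1r subrr normr0.
- apply: Fl; apply: tube_segm => //.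
  by exists 0; rewrite ?lexx ?ler01// scale0r subrr normr0.
Qed.

Lemma lift_global_unique (h : E -> M) F F' a : F a = F' a ->
  (forall x, lift_at h F x) -> (forall x, lift_at h F' x) -> F = F'.
Proof.
move=> F0 LF LF'; apply/funext => x.
exact: (lift_unique G atlas_cover (h := h) (a := a)).
Qed.

End GlobalLift.

Lemma lift_at_comp {R : realType} {U V W : normedModType R}
    (mul : W -> W -> W) (Gam : set W)
    (h : V -> rcoset_space mul Gam) F (u : U -> V) (x : U) :
  {for x, continuous u} -> lift_at h F (u x) ->
  lift_at (h \o u) (F \o u) x.
Proof.
move=> uc [Fc hF]; split; first exact: continuous_comp.
exact: (uc _ hF).
Qed.

(** * Lifts of diffeomorphisms and the isomorphism of deck groups *)

Section SmoothContinuous.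
Context {R : realType} {V W : normedModType R}.
Context (mulV : V -> V -> V) (Gam : set V).
Context (mulW : W -> W -> W) (Del : set W).
Local Notation M := (rcoset_space mulV Gam).
Local Notation N := (rcoset_space mulW Del).
Local Notation prV := (rproj mulV Gam).
Local Notation prW := (rproj mulW Del).

(** Near [x] the map is the composite of the chart [a], the local expression, continuous by
    smoothness of order 0, and the projection, of which [b] is a section. *)
Lemma smooth_map_continuous (f : M -> N) :
  smooth_map (quotient_atlas mulV Gam) (quotient_atlas mulW Del) f ->
  continuous f.
Proof.
move=> fs x; have [a [b [aA bA ax ab sab]]] := fs x.
have oa := chart_open a.
have e : \forall y \near x, (prW \o (b \o f \o chart_inv a) \o a) y = f y.
  have : \forall y \near x, chart_dom a y by apply: open_nbhs_nbhs.
  apply: filterS => y ay /=.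
  rewrite chart_funK ?inE//; apply: bA; rewrite inE; apply: ab.
  by exists y.
rewrite /continuous_at -(nbhs_singleton e).
suff : {for x, continuous (prW \o (b \o f \o chart_inv a) \o a)}.
  by apply: cvg_trans; exact: (near_eq_cvg e).
apply: continuous_comp.
  have := @chart_continuous _ _ _ a.
  rewrite continuous_open_subspace//; apply; exact/mem_set.
apply: (@continuous_comp _ _ _ (b \o f \o chart_inv a) prW).
  by have [+ _] := sab 0%N; apply; exists x.
exact: rproj_continuous.
Qed.

End SmoothContinuous.

Section LiftEquivariant.
Context {R : realType} {V W : normedModType R}.
Context (mulV : V -> V -> V) (invV : V -> V) (Gam : set V).
Context (mulW : W -> W -> W) (invW : W -> W) (Del : set W).
Local Notation prV := (rproj mulV Gam).
Local Notation prW := (rproj mulW Del).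
Hypothesis GV : translation_group mulV invV Gam.
Hypothesis GW : translation_group mulW invW Del.

(** Translating the argument of [F] by [c] gives another lift of the same map. At 0 it differs from
    [F] by some [d] in [Del], hence everywhere by uniqueness. *)
Lemma lift_equivariant (f : rcoset_space mulV Gam -> rcoset_space mulW Del)
    (F : V -> W) c :
  (forall z, exists2 c, quotient_atlas mulW Del c & chart_dom c z) ->
  (forall x, lift_at (f \o prV) F x) -> Gam c ->
  exists2 d, Del d & forall x, F (mulV c x) = mulW d (F x).
Proof.
move=> coverW FL Gc.
have [d Dd Fd] : exists2 d, Del d & F (mulV c 0) = mulW d (F 0).
  apply/(rprojP GW); rewrite !(lift_atE (FL _)) /=.
  by rewrite (rprojM GV).
exists d => // x.
have fc : f \o prV = (f \o prV) \o mulV c.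
  by apply/funext => y /=; rewrite (rprojM GV).
suff /(congr1 (@^~ x)) : F \o mulV c = mulW d \o F by [].
apply: (lift_global_unique GW coverW (h := f \o prV) (a := 0)) => // y.
  by rewrite fc; apply: lift_at_comp => //; apply: (trans_continuous GV).
exact: (lift_at_translate GW).
Qed.

End LiftEquivariant.

Section DeckGroup.
Context {R : realType} {V W : normedModType R}.
Context (mulV : V -> V -> V) (invV : V -> V) (Gam : set V).
Context (mulW : W -> W -> W) (invW : W -> W) (Del : set W).
Local Notation prV := (rproj mulV Gam).
Local Notation prW := (rproj mulW Del).
Hypothesis GV : translation_group mulV invV Gam.
Hypothesis GW : translation_group mulW invW Del.

(** Lifts of a diffeomorphism and of its inverse can be chosen inverse to each other. Conjugation by
    them then exchanges the two groups of translations. *)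
Lemma diffeomorphic_deck_iso :
  diffeomorphic (quotient_atlas mulV Gam) (quotient_atlas mulW Del) ->
  exists (th : V -> W) (th' : W -> V),
  [/\ forall c, Gam c -> Del (th c), forall d, Del d -> Gam (th' d),
      forall c, Gam c -> th' (th c) = c, forall d, Del d -> th (th' d) = d &
      forall c c', Gam c -> Gam c' -> th (mulV c c') = mulW (th c) (th c')].
Proof.
move=> [f [g [fK gK fs gs]]].
(* Smoothness of a map provides a chart of the source at every point. *)
have coverV z : exists2 c, quotient_atlas mulV Gam c & chart_dom c z.
  by have [c [b []]] := fs z; exists c.
have coverW z : exists2 c, quotient_atlas mulW Del c & chart_dom c z.
  by have [c [b []]] := gs z; exists c.
have hc : continuous (f \o prV).
  move=> x; apply: (@continuous_comp _ _ _ prV f).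
    exact: rproj_continuous.
  exact: (smooth_map_continuous fs).
have kc : continuous (g \o prW).
  move=> x; apply: (@continuous_comp _ _ _ prW g).
    exact: rproj_continuous.
  exact: (smooth_map_continuous gs).
have [F F0 FL] := lift_global GW coverW hc (rprojK (f (prV 0))).
have [F1 F10 FL1] := lift_global GV coverV kc (rprojK (g (prW 0))).
(* [F1 (F 0)] lies over the same point as 0; the translation by [c0] brings it back to 0. *)
have [c0 Gc0 Fc0] : exists2 c, Gam c & 0 = mulV c (F1 (F 0)).
  apply/(rprojP GV); rewrite (lift_atE (FL1 _)) /= F0 rprojK; exact: fK.
pose F' := mulV c0 \o F1.
have FL' x : lift_at (g \o prW) F' x
  by exact: (lift_at_translate GV Gc0 (FL1 x)).
have kh x : g (prW (F x)) = prV x by rewrite (lift_atE (FL _)) /= fK.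
have hk y : f (prV (F' y)) = prW y by rewrite (lift_atE (FL' _)) /= gK.
have liftid x : lift_at prV id x.
  by split; [exact: cvg_id | exact: nearW].
have liftidW x : lift_at prW id x.
  by split; [exact: cvg_id | exact: nearW].
have F'F : F' \o F = id.
  apply: (lift_global_unique GV coverV (h := prV) (a := 0)) => // x.
  have -> : prV = (g \o prW) \o F by apply/funext => y /=; rewrite kh.
  by apply: lift_at_comp => //; case: (FL x).
(* The comparison is made at [F 0], since [F 0] may differ from 0. *)
have FF' : F \o F' = id.
  have FF'0 : F (F' (F 0)) = F 0 by have /(congr1 (@^~ 0)) /= -> := F'F.
  apply: (lift_global_unique GW coverW (h := prW) (a := F 0)) => // x.
  have -> : prW = (f \o prV) \o F' by apply/funext => y /=; rewrite hk.
  by apply: lift_at_comp => //; case: (FL' x).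
have F'FE x : F' (F x) = x by have /(congr1 (@^~ x)) := F'F.
have FF'E x : F (F' x) = x by have /(congr1 (@^~ x)) := FF'.
have /choice[th thP] c : exists d, Gam c ->
    Del d /\ forall x, F (mulV c x) = mulW d (F x).
  have [Gc|nGc] := pselect (Gam c); last by exists 0.
  by have [d Dd Fd] := lift_equivariant GV GW coverW FL Gc; exists d.
have /choice[th' thP'] d : exists c, Del d ->
    Gam c /\ forall x, F' (mulW d x) = mulV c (F' x).
  have [Dd|nDd] := pselect (Del d); last by exists 0.
  by have [c Gc Fc] := lift_equivariant GW GV coverV FL' Dd; exists c.
have LV := trans_law GV; have LW := trans_law GW.
exists th, th'; split=> [c /thP[]|d /thP'[]|c Gc|d Dd|c c' Gc Gc'] //.
- have [Dt Ft] := thP c Gc; have [_ Ft'] := thP' _ Dt.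
  apply: (@law_injl _ _ _ LV 0).
  by rewrite -[in RHS](F'FE (mulV c 0)) Ft Ft' F'FE.
- have [Gt Ft'] := thP' d Dd; have [_ Ft] := thP _ Gt.
  apply: (@law_injl _ _ _ LW 0).
  by rewrite -[in RHS](FF'E (mulW d 0)) Ft' Ft FF'E.
- have [_ Fc] := thP c Gc; have [_ Fc'] := thP c' Gc'.
  have [_ Fcc'] := thP _ (transM GV Gc Gc').
  apply: (@law_injl _ _ _ LW (F 0)).
  by rewrite -Fcc' -(lawA LV) Fc Fc' (lawA LW).
Qed.

End DeckGroup.

(** * Charts of a coset space and linear diffeomorphisms *)

Section SmoothLinear.
Context {R : realType} {V W : normedModType R}.

Lemma near_open (U : set V) (f g : V -> W) x : open U -> U x ->
  (forall y, U y -> f y = g y) -> \forall y \near x, f y = g y.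
Proof.
by move=> oU Ux fg; apply: filterS (open_nbhs_nbhs (conj oU Ux)) => y /fg.
Qed.

Lemma continuous_open_eq (U : set V) (f g : V -> W) x : open U -> U x ->
  (forall y, U y -> f y = g y) -> {for x, continuous g} ->
  {for x, continuous f}.
Proof.
move=> oU Ux fg gx; rewrite /prop_for/continuous_at fg//.
apply: cvg_trans gx; apply: near_eq_cvg.
by apply: (near_open oU Ux) => y /fg.
Qed.

(** [f] is taken constant only on [U], because the derivatives in the induction are known only
    there; after one derivation the constant is 0. *)
Lemma Ck_constant k (U : set V) (f : V -> W) a :
  open U -> (forall x, U x -> f x = a) -> Ck k U f.
Proof.
move=> oU; elim: k f a => [|k IHk] f a fa; split=> //.
- by move=> x Ux; apply: (continuous_open_eq oU Ux fa); exact: cst_continuous.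
- by move=> x Ux; apply: (continuous_open_eq oU Ux fa); exact: cst_continuous.
move=> v; split=> [x Ux|].
  apply: (near_eq_derivable (f := cst a)); last exact: derivable_cst.
  by apply: (near_open oU Ux) => y /fa.
apply: (IHk _ 0) => x Ux; rewrite (near_eq_derive (g := cst a)).
  exact: derive_cst.
exact: (near_open oU Ux).
Qed.

Lemma smooth_on_linear (U : set V) (f : V -> W) (l : {linear V -> W}) :
  continuous l -> open U -> (forall x, U x -> f x = l x) -> smooth_on U f.
Proof.
move=> lc oU fl [|k]; split=> //.
- by move=> x Ux; apply: (continuous_open_eq oU Ux fl); exact: lc.
- by move=> x Ux; apply: (continuous_open_eq oU Ux fl); exact: lc.
move=> v; split=> [x Ux|].
  apply: (near_eq_derivable (f := l)); last first.
    by apply: diff_derivable; apply: linear_differentiable.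
  by apply: (near_open oU Ux) => y /fl.
apply: (@Ck_constant _ _ _ (l v)) => // x Ux; rewrite (near_eq_derive (g := l)).
  by rewrite deriveE ?diff_lin//; apply: linear_differentiable.
exact: (near_open oU Ux).
Qed.

End SmoothLinear.

Section Quotient.
Context {R : realType} {V : normedModType R}.
Context (mul : V -> V -> V) (inv : V -> V) (Gam : set V).
Local Notation M := (rcoset_space mul Gam).
Local Notation pr := (rproj mul Gam).
Hypothesis G : translation_group mul inv Gam.
Let L := trans_law G.

Lemma open_translate c (U : set V) : Gam c -> open U -> open (mul c @` U).
Proof.
move=> Gc oU; have -> : mul c @` U = mul (inv c) @^-1` U.
  apply/seteqP; split=> [_ [x Ux <-]|x Ux] /=; first by rewrite (lawKl L).
  by exists (mul (inv c) x) => //; rewrite (lawVKl L).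
move/continuousP: (trans_continuous G (transV G Gc));
  by apply.
Qed.

Lemma rproj_open_map (U : set V) : open U -> open (pr @` U).
Proof.
move=> oU; apply: rproj_open.
have -> : pr @^-1` (pr @` U) = \bigcup_(c in Gam) (mul c @` U).
  apply/seteqP; split=> [x [y Uy /(rprojP G)[c Gc ->]]|x [c Gc [y Uy <-]]] /=.
    by exists c => //; exists y.
  by exists y => //; rewrite (rprojM G).
by apply: bigcup_open => c Gc; apply: open_translate.
Qed.

(** The chart is the inverse of the projection on [B], and its continuity is the openness of the
    projection. *)
Lemma quotient_chart (B : set V) :
  open B -> (forall x y, B x -> B y -> pr x = pr y -> x = y) ->
  exists2 c : chart V M, quotient_atlas mul Gam c &
   [/\ chart_dom c = pr @` B, chart_fun c @` chart_dom c = B,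
       forall x, B x -> c (pr x) = x & forall x, chart_inv c x = pr x].
Proof.
move=> oB injB.
pose s z : V := xget 0 [set x | B x /\ pr x = z].
have sE x : B x -> s (pr x) = x.
  move=> Bx; rewrite /s; case: xgetP => [y _ [By /injB]|/(_ x)]; last by case.
  by apply.
have sB : s @` (pr @` B) = B.
  apply/seteqP; split=> [_ [_ [x Bx <-] <-]|x Bx]; first by rewrite sE.
  by exists (pr x); [exists x|exact: sE].
have oP : open (pr @` B) by exact: rproj_open_map.
have oS : open (s @` (pr @` B)) by rewrite sB.
have sK : {in pr @` B, cancel s pr}.
  by move=> z; rewrite inE => -[x Bx <-]; rewrite sE.
have sc : {within pr @` B, continuous s}.
  rewrite continuous_open_subspace// => z; rewrite inE => -[x Bx <-].
  move=> U /=; rewrite sE// nbhsE; case=> O [oO Ox] OU.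
  have : open_nbhs (pr x) (pr @` (O `&` B)).
    by split; [apply: rproj_open_map; exact: openI | exists x].
  move/open_nbhs_nbhs; apply: filterS => _ [y [Oy By] <-].
  by rewrite /= sE//; apply: OU.
have pc : {within s @` (pr @` B), continuous pr}.
  by apply: continuous_subspaceT; exact: rproj_continuous.
exists (Chart oP oS sK sc pc); last by split.
exact: sK.
Qed.

End Quotient.

Section Descent.
Context {R : realType} {V W : normedModType R}.
Context (mulV : V -> V -> V) (invV : V -> V) (Gam : set V).
Context (mulW : W -> W -> W) (invW : W -> W) (Del : set W).
Local Notation prV := (rproj mulV Gam).
Local Notation prW := (rproj mulW Del).
Hypothesis GV : translation_group mulV invV Gam.
Hypothesis GW : translation_group mulW invW Del.

(** Defined through chosen representatives; [descentE] gives independence of the choice for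
    homomorphisms that respect the subgroups. *)
Definition descent (f : V -> W) (z : rcoset_space mulV Gam) :
  rcoset_space mulW Del := prW (f (repr z)).

Lemma descentE f x : (forall x y, f (mulV x y) = mulW (f x) (f y)) ->
  (forall c, Gam c -> Del (f c)) -> descent f (prV x) = prW (f x).
Proof.
move=> fM fG; apply/esym.
have [c Gc e] : exists2 c, Gam c & repr (prV x) = mulV c x.
  by apply/(rprojP GV); rewrite rprojK.
by rewrite /descent e fM (rprojM GW)//; apply: fG.
Qed.

Hypothesis discrete : forall x : V, exists2 B, open B /\ B x &
  forall c y, Gam c -> B y -> B (mulV c y) -> c = 0.

(** The projections are injective on a small open [B] and on its image under [f]. In the charts that
    these sets define, the descended map is [f] itself, which is linear and continuous. *)
Lemma smooth_descent (f : {linear V -> W}) (g : W -> V) :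
  continuous f -> continuous g -> cancel f g -> cancel g f ->
  (forall x y, f (mulV x y) = mulW (f x) (f y)) ->
  (forall c, Gam c -> Del (f c)) -> (forall d, Del d -> Gam (g d)) ->
  smooth_map (quotient_atlas mulV Gam) (quotient_atlas mulW Del) (descent f).
Proof.
move=> fc gc fK gK fM fG gD z.
rewrite -(rprojK z); move: (repr z) => x.
have [B [oB Bx] BG] := discrete x.
have injB y y' : B y -> B y' -> prV y = prV y' -> y = y'.
  move=> By By' /(rprojP GV)[c Gc e]; rewrite e (BG c y)// -?e//.
  by rewrite (law0l (trans_law GV)).
have fB : f @` B = g @^-1` B.
  apply/seteqP; split=> [_ [y By <-]|y By] /=; first by rewrite fK.
  by exists (g y) => //; rewrite gK.
have ofB : open (f @` B) by rewrite fB; move/continuousP: gc;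
  by apply.
have injfB y y' : (f @` B) y -> (f @` B) y' -> prW y = prW y' -> y = y'.
  move=> [u Bu <-] [u' Bu' <-] /(rprojP GW)[d Dd e]; congr (f _).
  apply: injB => //; apply/(rprojP GV); exists (g d); first exact: gD.
  by apply: (can_inj fK); rewrite e fM gK.
have [a aA [ad aB ap ai]] := quotient_chart GV oB injB.
have [b bA [bd bB bp bi]] := quotient_chart GW ofB injfB.
exists a, b; split=> //.
- by rewrite ad; exists x.
- rewrite ad bd => _ [_ [y By <-] <-]; rewrite descentE//.
  by exists (f y) => //; exists y.
- rewrite aB; apply: (smooth_on_linear (l := f)) => // y By /=.
  by rewrite ai descentE// bp//; exists y.
Qed.

End Descent.

Lemma diffeomorphic_linear {R : realType} {V W : normedModType R}
    (mulV : V -> V -> V) (invV : V -> V) (Gam : set V)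
    (mulW : W -> W -> W) (invW : W -> W) (Del : set W)
    (f : {linear V -> W}) (g : {linear W -> V}) :
  translation_group mulV invV Gam -> translation_group mulW invW Del ->
  (forall x : V, exists2 B, open B /\ B x &
     forall c y, Gam c -> B y -> B (mulV c y) -> c = 0) ->
  (forall x : W, exists2 B, open B /\ B x &
     forall c y, Del c -> B y -> B (mulW c y) -> c = 0) ->
  continuous f -> continuous g -> cancel f g -> cancel g f ->
  (forall x y, f (mulV x y) = mulW (f x) (f y)) ->
  (forall c, Gam c -> Del (f c)) -> (forall d, Del d -> Gam (g d)) ->
  diffeomorphic (quotient_atlas mulV Gam) (quotient_atlas mulW Del).
Proof.
move=> GV GW dV dW fc gc fK gK fM fG gD.
have gM x y : g (mulW x y) = mulV (g x) (g y).
  by apply: (can_inj fK); rewrite fM !gK.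
exists (descent mulW Del f), (descent mulV Gam g); split.
- move=> z; rewrite -(rprojK z) (descentE GV GW)// (descentE GW GV)//.
  by rewrite fK.
- move=> z; rewrite -(rprojK z) (descentE GW GV)// (descentE GV GW)//.
  by rewrite gK.
- exact: (smooth_descent GV GW dV fc gc).
- exact: (smooth_descent GW GV dW gc fc).
Qed.

(** * Solvable groups and their lattices *)

Section MatrixLimits.
Context {R : realType}.

Lemma cvg_mx_entry (T : Type) (F : set_system T) {FF : Filter F} m n
    (f : T -> 'M[R]_(m, n)) (M : 'M[R]_(m, n)) :
  (forall i j, f x i j @[x --> F] --> M i j) -> f x @[x --> F] --> M.
Proof.
move=> fM A [P MP PA].
have : \forall x \near F, forall i j, P i j (f x i j).
  apply: filter_forall => i; apply: filter_forall => j.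
  exact: (fM i j _ (MP i j)).
by apply: filterS => x fP; apply: PA.
Qed.

Lemma mulmx_continuous m n (A : 'M[R]_(m, n)) :
  continuous (fun v : 'cV[R]_n => A *m v).
Proof.
move=> v; apply: (@cvg_mx_entry _ (nbhs v)) => i j.
under eq_fun do rewrite mxE; rewrite mxE.
apply: (@cvg_big _ _ +%R _ _ _ _ _ _ (fun k (x : 'cV[R]_n) => A i k * x k j)).
  exact: add_continuous.
move=> k _; apply: cvgM; first exact: cvg_cst.
exact: coord_continuous.
Qed.

Lemma diag_mx_exp m (d : 'rV[R]_m) k :
  diag_mx d ^+ k = diag_mx (map_mx (fun x => x ^+ k) d).
Proof.
elim: k => [|k IHk].
  rewrite expr0 (_ : map_mx _ _ = const_mx 1) ?diag_const_mx//.
  by apply/rowP => i; rewrite !mxE expr0.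
rewrite exprS IHk -[LHS]/(_ *m _) mulmx_diag; congr diag_mx.
by apply/rowP => i; rewrite !mxE exprS.
Qed.

(** Entry by entry, the partial sums are those of the scalar exponential series on the diagonal and
    0 off it. *)
Lemma expmx_diag m (d : 'rV[R]_m) : expmx (diag_mx d) = diag_mx (map_mx expR d).
Proof.
rewrite /expmx; apply: cvg_lim; first exact: norm_hausdorff.
apply: cvg_mx_entry => i j.
rewrite (_ : (fun x => _) =
    fun n => series (exp_coeff (d 0 j)) n *+ (i == j)); last first.
  apply/funext => n; rewrite /series /= summxE -sumrMnl.
  apply: eq_bigr => k _; rewrite diag_mx_exp !mxE eq_sym.
  by case: eqVneq => [->|_]; rewrite ?mulr0n ?mulr0// !mulr1n mulrC.
rewrite !mxE eq_sym; case: eqVneq => [->|_].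
  rewrite !mulr1n; exact: is_cvg_series_exp_coeff.
by rewrite mulr0n; exact: cvg_cst.
Qed.

End MatrixLimits.

Section SolvGroup.
Context {R : realType} {n : nat}.
Local Notation N := (solv_dim n).
Implicit Types p : {poly int}.

(** The diagonal of A_p, written as a row so that phi_p reduces to scalar exponentials. *)
Definition solv_weights p : 'rV[R]_N :=
  let d := \row_(i < n) ln (real_roots p)`_i in
  row_mx 0 (row_mx d (row_mx d (row_mx d d))).

Lemma solv_phiE p t : solv_phi n p t =
  diag_mx (map_mx (fun a => expR (t * a)) (solv_weights p)) :> 'M[R]_N.
Proof.
rewrite /solv_phi /solv_mx /dsum4 -(linear0 diag_mx) -!diag_mx_row -linearZ.
rewrite expmx_diag; congr diag_mx.
by apply/rowP => i; rewrite !mxE.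
Qed.

Lemma solv_phi0 p : solv_phi n p 0 = 1%:M :> 'M[R]_N.
Proof.
rewrite solv_phiE (_ : map_mx _ _ = const_mx 1) ?diag_const_mx//.
by apply/rowP => i; rewrite !mxE mul0r expR0.
Qed.

Lemma solv_phiD p s t :
  solv_phi n p (s + t) = solv_phi n p s *m solv_phi n p t :> 'M[R]_N.
Proof.
rewrite !solv_phiE mulmx_diag; congr diag_mx.
by apply/rowP => i; rewrite !mxE mulrDl expRD.
Qed.

Lemma solv_phiVK p t : solv_phi n p (- t) *m solv_phi n p t = 1%:M :> 'M[R]_N.
Proof. by rewrite -solv_phiD addNr solv_phi0. Qed.

Definition solv_inv p (g : @solv_group R n) : @solv_group R n :=
  (- g.1, - (solv_phi n p (- g.1) *m g.2)).

Lemma solv_group_law p : group_law (solv_mul p) (solv_inv p).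
Proof.
split.
- move=> [r x] [s y] [t z]; rewrite /solv_mul /=; congr pair.
    by rewrite addrA.
  by rewrite mulmxDr addrA solv_phiD mulmxA.
- by move=> [r x]; rewrite /solv_mul /= !add0r solv_phi0 mul1mx.
- by move=> [r x]; rewrite /solv_mul /= !addNr.
Qed.

Lemma solv_mul0 p v (h : @solv_group R n) :
  solv_mul p (0, v) h = (h.1, v + h.2).
Proof. by rewrite /solv_mul /= add0r solv_phi0 mul1mx. Qed.

Lemma solv_mul_continuous p (g : @solv_group R n) : continuous (solv_mul p g).
Proof.
move=> h.
apply: (@cvg_pair _ _ _ (nbhs h) (nbhs (g.1 + h.1))
  (nbhs (g.2 + solv_phi n p g.1 *m h.2))).
  by apply: cvgD; [exact: cvg_cst | exact: cvg_fst].
apply: cvgD; first exact: cvg_cst.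
apply: (@continuous_comp _ _ _ snd (mulmx (solv_phi n p g.1))).
  exact: cvg_snd.
exact: mulmx_continuous.
Qed.

(** Since [C] is invertible over the integers, phi(1) and phi(-1) both act by integer matrices in
    the basis [Q], and so does phi(k) for every integer k. *)
Lemma solv_lattice_group p (Q : 'M[R]_N) (C : 'M[int]_N) :
  C \in unitmx -> solv_phi n p 1 *m Q = Q *m map_mx intr C ->
  translation_group (solv_mul p) (solv_inv p) (solv_lattice Q).
Proof.
move=> Cu QC.
have QC' : solv_phi n p (- 1) *m Q = Q *m map_mx intr (invmx C).
  rewrite -[LHS]mulmx1 -(map_mx1 intr) -(mulmxV Cu) map_mxM mulmxA.
  by rewrite -(mulmxA (solv_phi n p _)) -QC mulmxA solv_phiVK mul1mx.
(* Applied below with [e] equal to 1 and to -1, to reach all integer times. *)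
have QD (e : R) (D : 'M[int]_N) (k : nat) :
    solv_phi n p e *m Q = Q *m map_mx intr D ->
    exists D' : 'M[int]_N, solv_phi n p (e * k%:R) *m Q = Q *m map_mx intr D'.
  move=> eD; elim: k => [|k [D' IH]].
    by exists 1%:M; rewrite mulr0 solv_phi0 map_mx1 mul1mx mulmx1.
  exists (D' *m D); rewrite -natr1 mulrDr mulr1 solv_phiD -mulmxA eD mulmxA IH.
  by rewrite map_mxM mulmxA.
have Qint (k : int) : exists D : 'M[int]_N,
    solv_phi n p k%:~R *m Q = Q *m map_mx intr D.
  case: k => k; first by have := QD _ _ k QC; rewrite mul1r.
  by have := QD _ _ k.+1 QC'; rewrite mulN1r NegzE mulrNz.
split.
- exact: solv_group_law.
- by exists 0, 0; rewrite map_mx0 mulmx0.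
- move=> _ _ [k [z ->]] [l [w ->]]; have [D kD] := Qint k.
  exists (k + l), (z + D *m w); rewrite /solv_mul /= intrD; congr pair.
  by rewrite mulmxA kD map_mxD mulmxDr map_mxM mulmxA.
- move=> _ [k [z ->]]; have [D kD] := Qint (- k).
  exists (- k), (- (D *m z)); rewrite /solv_inv /= mulrNz; congr pair.
  by rewrite mulmxA -mulrNz kD map_mxN mulmxN map_mxM mulmxA.
- by move=> x _; exact: solv_mul_continuous.
Qed.

Lemma int_lt1_eq0 (k : int) : `|k%:~R : R| < 1 -> k = 0.
Proof.
by rewrite -intr_norm -[1]/(1%:~R) ltr_int -[1]add0r ltzD1 normr_le0 => /eqP.
Qed.

(** In the coordinates given by [Q], two points within 1/2 of [x] differ by less than 1 in each
    coordinate. This forces first k = 0; the translation then shifts the coordinates by the integer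
    vector [z], so [z] = 0. *)
Lemma solv_lattice_discrete p (Q : 'M[R]_N) (x : @solv_group R n) :
  Q \in unitmx ->
  exists2 B, open B /\ B x &
    forall c y, solv_lattice Q c -> B y -> B (solv_mul p c y) -> c = 0.
Proof.
move=> Qu.
pose u (y : @solv_group R n) i := (invmx Q *m y.2) i 0.
have uc i : continuous (u^~ i).
  move=> y; apply: (@continuous_comp _ _ _ (fun y => invmx Q *m y.2)
    (fun v : 'cV[R]_N => v i 0)).
    apply: (@continuous_comp _ _ _ snd (mulmx (invmx Q))); first exact: cvg_snd.
    exact: mulmx_continuous.
  exact: coord_continuous.
pose A : set (@solv_group R n) :=
  [set y | `|y.1 - x.1| < 2^-1 /\ forall i, `|u y i - u x i| < 2^-1].
have : nbhs x A.
  apply: filterI.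
    have : y.1 @[y --> x] --> x.1 by exact: cvg_fst.
    by move=> /cvgr_distC_lt; apply; rewrite invr_gt0.
  apply: (@filter_forall _ _ _ (nbhs x)) => i; have := uc i x.
  by move=> /cvgr_distC_lt; apply; rewrite invr_gt0.
rewrite nbhsE => -[B [oB Bx] BA]; exists B => // _ y [k [z ->]] /BA[/= y1 yu].
move=> /BA[/= ky kyu].
have k0 : k = 0.
  apply: int_lt1_eq0; have := ltrD ky y1.
  rewrite -[2^-1]mul1r -splitr; apply: le_lt_trans; rewrite [`|y.1 - _|]distrC.
  apply: le_trans _ (ler_normD _ _).
  by rewrite addrA subrK addrK.

have z0 : z = 0.
  apply/matrixP => i j; rewrite mxE [j]ord1; apply: int_lt1_eq0.
  have := ltrD (kyu i) (yu i).
  rewrite -[2^-1]mul1r -splitr; apply: le_lt_trans.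
  rewrite [`|u y i - _|]distrC.
  apply: le_trans _ (ler_normD _ _); rewrite addrA subrK.
  by rewrite /u /solv_mul /= k0 solv_phi0 mul1mx mulmxDr mulKmx// !mxE addrK.
by rewrite k0 z0 map_mx0 mulmx0.
Qed.

End SolvGroup.

(** * Companion matrices and roots *)

Section DirectSum.
Context {S : pzRingType} {n : nat}.

Lemma mul_dsum4 (E F : 'M[S]_3) (X Y : 'M[S]_n) :
  dsum4 E X *m dsum4 F Y = dsum4 (E *m F) (X *m Y).
Proof.
by rewrite /dsum4 !mulmx_block !(mul0mx, mulmx0, addr0, add0r).
Qed.

Lemma dsum4_1 : dsum4 1%:M 1%:M = 1%:M :> 'M[S]_(solv_dim n).
Proof. by rewrite /dsum4 -!scalar_mx_block. Qed.

End DirectSum.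

Lemma dsum4_unitmx (S : comUnitRingType) n (E : 'M[S]_3) (X : 'M[S]_n) :
  E \in unitmx -> X \in unitmx -> dsum4 E X \in unitmx.
Proof.
move=> Eu Xu.
have e : dsum4 E X *m dsum4 (invmx E) (invmx X) = 1%:M.
  by rewrite mul_dsum4 !mulmxV// dsum4_1.
clear Eu Xu; have [u _] := mulmx1_unit e; exact: u.
Qed.

Section Companion.
Context {n : nat}.
Implicit Types p : {poly int}.

(** The size of [p] makes the dimensions match, so [conform_mx] does not return its default 0. *)
Lemma companionE p (i j : 'I_n) : size p = n.+1 ->
  companion n p i j = if i == n.-1 :> nat then - p`_j else (i.+1 == j)%:R.
Proof.
move=> sp; rewrite /companion /companionmx.
have -> : (size p).-1 = n by rewrite sp.
by rewrite conform_mx_id mxE.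
Qed.

Lemma coef_star p i : (i <= n)%N -> (star n p)`_i = (-1) ^+ n * p`_(n - i).
Proof. by move=> ni; rewrite /star coefZ coef_poly ltnS ni. Qed.

(** The constant coefficient (-1)^n of [p] turns into the leading coefficient 1. *)
Lemma size_star p : p`_0 = (-1) ^+ n -> size (star n p) = n.+1.
Proof.
move=> p0; apply/eqP; rewrite eqn_leq; apply/andP; split.
  by rewrite /star size_scale ?signr_eq0// size_poly.
rewrite ltnNge; apply/negP => /(nth_default 0)/eqP.
by rewrite coef_star// subnn p0 -expr2 sqrr_sign oner_eq0.
Qed.

Lemma monic_star p : p`_0 = (-1) ^+ n -> star n p \is monic.
Proof.
move=> p0; rewrite monicE lead_coefE size_star//= coef_star// subnn p0.
by rewrite -expr2 sqrr_sign.
Qed.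

Lemma starK p : size p = n.+1 -> star n (star n p) = p.
Proof.
move=> sp; apply/polyP => i; have [ni|ni] := leqP i n.
  by rewrite !coef_star ?leq_subr// subKn// signrMK.
rewrite !nth_default ?sp// /star.
by apply: leq_trans (size_scale_leq _ _) _; apply: leq_trans (size_poly _ _) _.
Qed.

Definition flip_mx : 'M[int]_n := \matrix_(i, j) (i == rev_ord j)%:R.

Lemma flip_mxK : flip_mx *m flip_mx = 1%:M.
Proof.
apply/matrixP => i j; rewrite !mxE (bigD1 (rev_ord j)) //= big1 => [|k kj].
  by rewrite !mxE rev_ordK eqxx mulr1 addr0.
by rewrite !mxE (negPf kj) mulr0.
Qed.

Lemma flip_mx_unit : flip_mx \in unitmx.
Proof. by case/mulmx1_unit: flip_mxK. Qed.

(* On Z[x]/(p), multiplication by x has matrix C_p in the basis of powers of x,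
   and multiplication by 1/x has matrix C_q, q = p^*, in the basis of powers of 1/x;
   up to a unit, each basis is the other one reversed. *)
Lemma companion_star p : size p = n.+1 -> p \is monic -> p`_0 = (-1) ^+ n ->
  companion n p *m flip_mx *m companion n (star n p) = flip_mx.
Proof.
move=> sp mp p0; have ss := size_star p0.
have JE (A : 'M[int]_n) i j : (flip_mx *m A) i j = A (rev_ord i) j.
  rewrite mxE (bigD1 (rev_ord i)) //= big1 => [|k ki].
    by rewrite mxE rev_ordK eqxx mul1r addr0.
  by rewrite mxE -(inj_eq rev_ord_inj) rev_ordK eq_sym (negPf ki) mul0r.
rewrite -mulmxA; apply/matrixP => i j; rewrite mxE.
under eq_bigr do rewrite JE !companionE// /=.
have i_n := ltn_ord i; have j_n := ltn_ord j.
have [iE|iN] := eqVneq (i : nat) n.-1; last first.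
  have i1 : (i.+1 < n)%N by lia.
  rewrite (bigD1 (Ordinal i1)) //= big1 => [|k /eqP ki].
    rewrite eqxx mul1r addr0 !mxE ifN; last by lia.
    by congr (_%:R); congr nat_of_bool; rewrite -val_eqE /=; lia.
  case: eqP => [e|_]; last by rewrite mul0r.
  by case: ki; apply/val_inj.
(* Last row: the term k = 0 contributes p_(n-j) and the term k = n-j contributes -p_(n-j). For j = 0
   the second is absent, and p_n = 1 is left. *)
have n0 : (0 < n)%N by lia.
rewrite (bigD1 (Ordinal n0)) //= subn1 eqxx coef_star; last lia.
rewrite p0 mulrNN mulrA -expr2 sqrr_sign mul1r mxE.
have pn : p`_n = 1 by move: mp; rewrite monicE lead_coefE sp => /eqP.
have [j0|j0] := eqVneq (j : nat) 0%N.
  rewrite j0 subn0 pn big1 ?addr0 => [|k /eqP k0].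
    by rewrite -val_eqE /= j0 iE subn1 eqxx.
  rewrite ifN; last first.
    by apply/eqP => e; apply: k0; apply/val_inj => /=; have := ltn_ord k; lia.
  by rewrite (_ : _ == _ = false) ?mulr0//; apply/negbTE; lia.
have k0n : (n - j < n)%N by lia.
rewrite (bigD1 (Ordinal k0n)) /=; last by rewrite -val_eqE /=; lia.
rewrite big1 ?addr0 => [|k /andP[/eqP k0 /eqP k1]].
  rewrite ifN; last lia.
  rewrite (_ : _ == _ = true); last lia.
  rewrite mulr1 subrr (_ : _ == _ = false)//.
  by rewrite -val_eqE /=; apply/negbTE; lia.
rewrite ifN; last first.
  by apply/eqP => e; apply: k0; apply/val_inj => /=; have := ltn_ord k; lia.
rewrite (_ : _ == _ = false) ?mulr0//; apply/negbTE/eqP => e.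
by apply: k1; apply/val_inj => /=; have := ltn_ord k; lia.
Qed.

(** The companion matrix is a factor of the invertible matrix [flip_mx]. *)
Lemma companion_unit p : size p = n.+1 -> p \is monic -> p`_0 = (-1) ^+ n ->
  companion n p \in unitmx.
Proof.
move=> sp mp p0; have := flip_mx_unit; rewrite -(companion_star sp mp p0).
by rewrite !unitmx_mul -andbA => /andP[].
Qed.

End Companion.

Section Roots.
Context {R : realType} {n : nat}.
Implicit Types p q : {poly int}.
Local Notation pR p := (map_poly intr p : {poly R}).
Local Notation rs p := (@real_roots R p).

Lemma uniq_real_roots p : uniq (rs p).
Proof. exact: uniq_roots. Qed.

Lemma prod_roots (P : {poly R}) (s : seq R) : P \is monic ->
  size P = (size s).+1 -> uniq s -> {in s, forall x, root P x} ->
  P = \prod_(x <- s) ('X - x%:P).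
Proof.
move=> mP sP us rP; rewrite [LHS](@all_roots_prod_XsubC _ _ s) ?sP//.
- by rewrite (eqP (mP : lead_coef P == 1)) scale1r.
- exact/allP.
- by rewrite uniq_rootsE.
Qed.

Lemma Delta_prod p : Delta R n p -> pR p = \prod_(r <- rs p) ('X - r%:P).
Proof.
move=> [mp sp srp rp p0]; apply: prod_roots.
- exact: monic_map.
- rewrite size_map_poly_id0 ?srp// (eqP (mp : lead_coef p == 1)).
  by rewrite rmorph1 oner_eq0.
- exact: uniq_real_roots.
- move=> x xp; have : pR p != 0 by rewrite monic_neq0// monic_map.
  by move=> /roots_on_rootsR/(_ x); rewrite xp => /andP[].
Qed.

Lemma Delta_coef0 p : Delta R n p -> p`_0 = (-1) ^+ n.
Proof. by case=> _ _ _ _; rewrite horner_coef0. Qed.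

Lemma star_prod p : Delta R n p ->
  pR (star n p) = \prod_(x <- [seq r^-1 | r <- rs p]) ('X - x%:P).
Proof.
move=> Dp; have [mp sp srp rp _] := Dp; have p0 := Delta_coef0 Dp.
apply: prod_roots.
- by apply: monic_map; exact: monic_star.
- rewrite size_map_poly_id0 ?size_map ?srp ?size_star//.
  by rewrite (eqP (monic_star p0 : lead_coef _ == 1)) rmorph1 oner_eq0.
- by rewrite map_inj_uniq; [exact: uniq_real_roots | exact: invr_inj].
move=> _ /mapP[r rpr ->].
have r0 : r != 0 by rewrite gt_eqF// rp.
have : root (pR p) r by rewrite (Delta_prod Dp) root_prod_XsubC.
(* After multiplication by r^n, the value of [star n p] at 1/r becomes (-1)^n p(r), term by term
   once the summation is reversed. *)
rewrite /root => /eqP pr0; apply/eqP; apply: (mulfI (expf_neq0 n r0)).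
rewrite mulr0 -[RHS](mulr0 ((-1) ^+ n)) -[in RHS]pr0.
rewrite !(horner_coef_wide (n := n.+1)); last first.
- by rewrite (leq_trans (size_poly _ _))// size_star.
- by rewrite (leq_trans (size_poly _ _))// sp.
rewrite !mulr_sumr (reindex_inj rev_ord_inj) /=; apply: eq_bigr => i _.
have i_n : (i <= n)%N by rewrite -ltnS.
rewrite subSS !coef_map coef_star ?leq_subr// subKn//= rmorphM rmorphXn /=.
rewrite rmorphN1 exprVn -[in r ^+ n](subnKC i_n) exprD.
move: (expf_neq0 (n - i) r0); set x := r ^+ (n - i); set y := r ^+ i => x0.
by rewrite mulrACA mulrA [y * _]mulrC -!mulrA mulfV// mulr1.
Qed.

(** A positive power has the same roots as its base, and a product over distinct roots is determined
    by its set of roots. *)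
Lemma prod_exp_inj (s t : seq R) (c : {poly R}) m : (0 < m)%N -> c != 0 ->
  uniq s -> uniq t ->
  c * (\prod_(x <- s) ('X - x%:P)) ^+ m =
    c * (\prod_(x <- t) ('X - x%:P)) ^+ m ->
  \prod_(x <- s) ('X - x%:P) = \prod_(x <- t) ('X - x%:P).
Proof.
move=> m0 c0 us ut /(mulfI c0) e; apply: perm_big; apply: uniq_perm => // x.
rewrite -!root_prod_XsubC; move/(congr1 (root^~ x)): e.
by rewrite /root !horner_exp !expf_eq0 m0.
Qed.

Lemma map_expR_ln p : Delta R n p ->
  [seq expR (1 * ln r) | r <- rs p] = rs p.
Proof.
move=> [_ _ _ rp _]; rewrite -[RHS]map_id; apply/eq_in_map => r /rp r0.
by rewrite mul1r lnK.
Qed.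

Lemma map_expRN_ln p : Delta R n p ->
  [seq expR (-1 * ln r) | r <- rs p] = [seq r^-1 | r <- rs p].
Proof.
move=> [_ _ _ rp _]; apply/eq_in_map => r /rp r0.
by rewrite mulN1r expRN lnK.
Qed.

End Roots.

Lemma char_poly_intertwine (F : fieldType) m (S A B : 'M[F]_m) :
  S \in unitmx -> S *m A = B *m S -> char_poly A = char_poly B.
Proof.
move=> Su SAB; pose S' := map_mx polyC S.
have : \det S' * char_poly A = char_poly B * \det S'.
  rewrite /char_poly -!det_mulmx /char_poly_mx; congr (\det _).
  rewrite mulmxBr mulmxBl -!map_mxM SAB; congr (_ - _).
  by rewrite mul_mx_scalar mul_scalar_mx.
rewrite mulrC => /mulIf; apply.
by rewrite det_map_mx polyC_eq0 -unitfE -unitmxE.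
Qed.

(** Wherever an entry [S i j] is nonzero, exp(a_j) = exp(b_i), hence a_j = b_i, and the relation
    holds at every time [t]. *)
Lemma diag_intertwine (R : realType) m (S : 'M[R]_m) (a b : 'rV[R]_m) (t : R) :
  S *m diag_mx (map_mx expR a) = diag_mx (map_mx expR b) *m S ->
  S *m diag_mx (map_mx (fun x => expR (t * x)) a) =
  diag_mx (map_mx (fun x => expR (t * x)) b) *m S.
Proof.
move=> e; apply/matrixP => i j.
have : (S *m diag_mx (map_mx expR a)) i j = (diag_mx (map_mx expR b) *m S) i j.
  by rewrite e.
rewrite mul_mx_diag mul_diag_mx mul_mx_diag mul_diag_mx !mxE.
have [->|S0] := eqVneq (S i j) 0; first by rewrite !(mul0r, mulr0).
by rewrite mulrC => /(mulIf S0)/expR_inj ->; rewrite mulrC.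
Qed.

(** The matrix is diagonal: the three zero weights give the factor (X - 1)^3, and each of the four
    blocks gives the same product. *)
Lemma char_poly_solv_phi (R : realType) n p (e : R) :
  size (@real_roots R p) = n ->
  char_poly (solv_phi n p e) = ('X - 1%:P) ^+ 3 *
    (\prod_(x <- [seq expR (e * ln r) | r <- @real_roots R p])
       ('X - x%:P)) ^+ 4.
Proof.
move=> sp; rewrite solv_phiE char_poly_trig ?diag_mx_is_trig//.
have D (d : 'rV[R]_(solv_dim n)) f i :
    diag_mx (map_mx f d) i i = f (d 0 i) :> R.
  by rewrite !mxE eqxx.
rewrite (eq_bigr (fun i => 'X - (expR (e * solv_weights p 0 i))%:P));
  last first.
  by move=> i _; rewrite D.
set P := \prod_(x <- _) _.
have E (s : 'I_n -> R) : (forall i : 'I_n, s i = ln (@real_roots R p)`_i) ->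
    \prod_(i < n) ('X - (expR (e * s i))%:P) = P.
  move=> sE; rewrite /P big_map (big_nth 0) sp big_mkord.
  by apply: eq_bigr => i _; rewrite sE.
have P4 : P ^+ 4 = P * (P * (P * P)) by [].
rewrite !big_split_ord P4 /=; clear P4.
rewrite (E (fun i => solv_weights p 0 (rshift 3 (lshift (n + (n + n)) i)))).
  rewrite (E (fun i => solv_weights p 0
    (rshift 3 (rshift n (lshift (n + n) i))))).
    rewrite (E (fun i => solv_weights p 0
      (rshift 3 (rshift n (rshift n (lshift n i)))))).
      rewrite (E (fun i => solv_weights p 0
        (rshift 3 (rshift n (rshift n (rshift n i)))))).
        congr (_ * _); rewrite !big_ord_recl big_ord0 /solv_weights.
        by rewrite !row_mxEl !mxE !mulr0 expR0 !exprS expr0.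
      by move=> i; rewrite /solv_weights !row_mxEr mxE.
    by move=> i; rewrite /solv_weights !row_mxEr row_mxEl mxE.
  by move=> i; rewrite /solv_weights !row_mxEr row_mxEl mxE.
by move=> i; rewrite /solv_weights row_mxEr row_mxEl mxE.
Qed.

(** * From matrices to diffeomorphisms *)

Lemma intertwine_conj (K : comUnitRingType) m (f : {rmorphism int -> K})
    (A B P Q : 'M[K]_m) (C D T : 'M[int]_m) :
  P \in unitmx -> A *m P = P *m map_mx f C -> B *m Q = Q *m map_mx f D ->
  D *m T *m C = T ->
  B *m (Q *m map_mx f T *m invmx P) *m A = Q *m map_mx f T *m invmx P.
Proof.
move=> Pu AP BQ DTC.
have -> : A = P *m map_mx f C *m invmx P by rewrite -AP mulmxK.
rewrite !mulmxA BQ mulmxKV//.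
by rewrite -(mulmxA Q) -map_mxM -(mulmxA Q) -map_mxM DTC.
Qed.

Section LinearModel.
Context {R : realType} {n : nat}.
Local Notation N := (solv_dim n).
Local Notation G := (@solv_group R n).

Definition solv_map (e : R) (S : 'M[R]_N) (g : G) : G := (e * g.1, S *m g.2).

Lemma solv_map_linear e S : linear (solv_map e S).
Proof.
move=> a [r x] [s y]; rewrite /solv_map /=; congr pair.
  by rewrite mulrDr mulrCA.
by rewrite mulmxDr -scalemxAr.
Qed.

HB.instance Definition _ e S :=
  GRing.isLinear.Build R G G *:%R (solv_map e S) (solv_map_linear e S).

Lemma solv_map_continuous e S : continuous (solv_map e S).
Proof.
move=> h.
apply: (@cvg_pair _ _ _ (nbhs h) (nbhs (e * h.1)) (nbhs (S *m h.2))).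
  by apply: cvgM; [exact: cvg_cst | exact: cvg_fst].
apply: (@continuous_comp _ _ _ snd (mulmx S)); first exact: cvg_snd.
exact: mulmx_continuous.
Qed.

Implicit Types p q : {poly int}.
Implicit Types Q Qp Qq : 'M[R]_N.

Lemma Delta_companion_unit p : Delta R n p ->
  dsum4 1%:M (companion n p) \in unitmx.
Proof.
move=> Dp; have [mp sp _ _ _] := Dp.
apply: dsum4_unitmx; first exact: unitmx1.
by apply: companion_unit => //; apply: Delta_coef0 Dp.
Qed.

Lemma conjugates_mul p Q : conjugates p Q ->
  solv_phi n p 1 *m Q = Q *m map_mx intr (dsum4 1%:M (companion n p)).
Proof. by case=> Qu <-; rewrite -mulmxA mulKVmx. Qed.

Lemma Delta_translation_group p Q : Delta R n p -> conjugates p Q ->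
  translation_group (@solv_mul R n p) (@solv_inv R n p) (solv_lattice Q).
Proof.
move=> Dp cQ; apply: (solv_lattice_group (Delta_companion_unit Dp)).
exact: conjugates_mul.
Qed.

(** With [e] absorbed into the weights of [q], this is the passage from time 1 to all times for
    diagonal matrices. *)
Lemma solv_phi_intertwine p q (S : 'M[R]_N) (e t : R) :
  S *m solv_phi n p 1 = solv_phi n q e *m S ->
  S *m solv_phi n p t = solv_phi n q (e * t) *m S.
Proof.
rewrite !solv_phiE; move: (solv_weights p) (solv_weights q) => a b SE.
have -> : map_mx (fun x => expR (e * t * x)) b =
    map_mx (fun x => expR (t * x)) (e *: b).
  by apply/rowP => i; rewrite !mxE mulrA [t * e]mulrC.
apply: diag_intertwine; move: SE.
have -> : map_mx (fun x => expR (1 * x)) a = map_mx expR a.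
  by apply/rowP => i; rewrite !mxE mul1r.
have -> // : map_mx (fun x => expR (e * x)) b = map_mx expR (e *: b).
by apply/rowP => i; rewrite !mxE.
Qed.

(** An integer matrix [T] invertible over the integers makes S = Qq T Qp^-1 carry one fibre lattice
    onto the other; with [e] = 1 or -1, (t, v) |-> (e t, S v) is then a linear group isomorphism
    matching the lattices. *)
Lemma diffeomorphic_solv p q Qp Qq (e : int) (T : 'M[int]_N) :
  Delta R n p -> Delta R n q -> conjugates p Qp -> conjugates q Qq ->
  e * e = 1 -> T \in unitmx ->
  Qq *m map_mx intr T *m invmx Qp *m solv_phi n p 1 =
    solv_phi n q e%:~R *m (Qq *m map_mx intr T *m invmx Qp) ->
  diffeomorphic (solvmanifold p Qp) (solvmanifold q Qq).
Proof.
move=> Dp Dq cp cq ee Tu; set S := (X in X *m _ = _) => SE.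
have [Qpu _] := cp; have [Qqu _] := cq.
have eeR : e%:~R * e%:~R = 1 :> R by rewrite -intrM ee.
pose S' := Qp *m map_mx intr (invmx T) *m invmx Qq.
have SS' : S *m S' = 1%:M.
  rewrite /S /S' !mulmxA mulmxKV// -(mulmxA Qq) -map_mxM mulmxV// map_mx1.
  by rewrite mulmx1 mulmxV.
have S'S : S' *m S = 1%:M by exact: mulmx1C.
apply: (diffeomorphic_linear (f := solv_map e%:~R S) (g := solv_map e%:~R S')
  (Delta_translation_group Dp cp) (Delta_translation_group Dq cq)).
- by move=> x; apply: solv_lattice_discrete.
- by move=> x; apply: solv_lattice_discrete.
- exact: solv_map_continuous.
- exact: solv_map_continuous.
- by move=> [s x]; rewrite /= /solv_map /= mulmxA mulrA eeR S'S mul1r mul1mx.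
- by move=> [s x]; rewrite /= /solv_map /= mulmxA mulrA eeR SS' mul1r mul1mx.
- move=> [s x] [t y]; rewrite /= /solv_map /solv_mul /=; congr pair.
    by rewrite mulrDr.
  by rewrite mulmxDr mulmxA (solv_phi_intertwine _ SE) -mulmxA.
- move=> _ [k [z ->]]; exists (e * k), (T *m z).
  rewrite /= /solv_map /=; congr pair; first by rewrite intrM.
  by rewrite /S -!mulmxA mulKmx// map_mxM.
- move=> _ [k [z ->]]; exists (e * k), (invmx T *m z).
  rewrite /= /solv_map /=; congr pair; first by rewrite intrM.
  by rewrite /S' -!mulmxA mulKmx// map_mxM.
Qed.

(** Independence of the conjugating matrix, realised by S = Qq Qp^-1. *)
Lemma diffeomorphic_eq p Qp Qq :
  Delta R n p -> conjugates p Qp -> conjugates p Qq ->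
  diffeomorphic (solvmanifold p Qp) (solvmanifold p Qq).
Proof.
move=> Dp cp cq; apply: (@diffeomorphic_solv _ _ _ _ 1 1%:M) => //.
  exact: unitmx1.
have [Qpu _] := cp.
rewrite map_mx1 mulmx1 !mulmxA conjugates_mul//.
have -> : solv_phi n p 1 =
    Qp *m map_mx intr (dsum4 1%:M (companion n p)) *m invmx Qp.
  by rewrite -conjugates_mul// mulmxK.
by rewrite !mulmxA mulmxKV.
Qed.

(** Time is reversed, and the basis of each copy of Z^n is reversed by [flip_mx]. *)
Lemma diffeomorphic_star p Qp Qq :
  Delta R n p -> Delta R n (star n p) ->
  conjugates p Qp -> conjugates (star n p) Qq ->
  diffeomorphic (solvmanifold p Qp) (solvmanifold (star n p) Qq).
Proof.
move=> Dp Dq cp cq; have [mp sp _ _ _] := Dp; have [mq sq _ _ _] := Dq.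
have [Qpu _] := cp; have [Qqu _] := cq.
pose T : 'M[int]_N := dsum4 1%:M flip_mx.
have Tu : T \in unitmx.
  by apply: dsum4_unitmx; [exact: unitmx1 | exact: flip_mx_unit].
apply: (@diffeomorphic_solv _ _ _ _ (-1) T) => //.
have CTC : dsum4 1%:M (companion n (star n p)) *m T *m
    dsum4 1%:M (companion n p) = T.
  (* [companion_star] is used for [star n p], whose own star is [p]. *)
  rewrite !mul_dsum4 !mulmx1 -[in companion n p](starK sp).
  by rewrite companion_star// (Delta_coef0 Dq).
set S := Qq *m _ *m _.
suff H : solv_phi n (star n p) 1 *m S *m solv_phi n p 1 = S.
  rewrite -[in RHS]H !mulmxA -[RHS]mulmxA.
  by rewrite (_ : (-1)%:~R = - 1 :> R) // !mulmxA solv_phiVK mul1mx.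
exact: (intertwine_conj Qpu (conjugates_mul cp) (conjugates_mul cq)).
Qed.

End LinearModel.

(** * From lattice isomorphisms to matrices *)

Lemma morph_int (U V : zmodType) (h : U -> V) (k : int) x :
  {morph h : x y / x + y} -> h (x *~ k) = h x *~ k.
Proof.
move=> hD; have h0 : h 0 = 0 by apply: (addIr (h 0)); rewrite -hD !add0r.
have hN y : h (- y) = - h y.
  by apply: (addIr (h y)); rewrite -hD !addNr h0.
have hn m : h (x *+ m) = h x *+ m.
  by elim: m => [|m IHm]; rewrite ?mulr0n ?h0// !mulrS hD IHm.
by case: k => m; rewrite ?NegzE ?mulrNz ?hN -!pmulrn hn.
Qed.

Section LatticeIsomorphism.
Context {R : realType} {n : nat}.
Local Notation N := (solv_dim n).
Local Notation G := (@solv_group R n).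
Implicit Types p q : {poly int}.
Implicit Types Q Qp Qq : 'M[R]_N.

Lemma int_cols_inj m Q (A B : 'M[R]_(m, N)) : Q \in unitmx ->
  (forall z : 'cV[int]_N,
     A *m (Q *m map_mx intr z) = B *m (Q *m map_mx intr z)) ->
  A = B.
Proof.
move=> Qu AB; apply: (can_inj (mulmxK Qu)); apply/matrixP => i j.
have := AB (delta_mx j 0); rewrite map_delta_mx !mulmxA -!colE.
by move=> /matrixP/(_ i 0); rewrite !mxE.
Qed.

Lemma solv_weights_neq0 p : (2 <= n)%N -> Delta R n p ->
  exists j, (solv_weights p : 'rV[R]_N) 0 j != 0.
Proof.
move=> n2 [mp sp srp rp _].
have n1 : (1 < n)%N by []. have n0 : (0 < n)%N by exact: ltn_trans n1.
pose r i := (@real_roots R p)`_i.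
have rP i : (i < n)%N -> 0 < r i by move=> ni; apply: rp; rewrite mem_nth ?srp.
suff [i ri] : exists i : 'I_n, ln (r i) != 0.
  exists (rshift 3 (lshift _ i)); rewrite /solv_weights row_mxEr row_mxEl mxE.
  exact: ri.
have [r0|] := eqVneq (ln (r 0)) 0; last by exists (Ordinal n0).
exists (Ordinal n1) => /=; apply/eqP => r1.
(* Of two distinct roots at most one equals 1; this is where n >= 2 enters. *)
have : r 0 = r 1 by apply: ln_inj; rewrite ?posrE ?rP// r0 r1.
by move/eqP; rewrite nth_uniq ?srp//; exact: uniq_real_roots.
Qed.

Lemma solv_phi_unipotent p (k : int) : (2 <= n)%N -> Delta R n p ->
  (solv_phi n p k%:~R - 1%:M) *m (solv_phi n p k%:~R - 1%:M) = 0 :> 'M[R]_N ->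
  k = 0.
Proof.
move=> n2 Dp; have [j wj] := solv_weights_neq0 n2 Dp.
rewrite solv_phiE; move: (solv_weights p) wj => w wj.
rewrite -diag_const_mx -linearB /= mulmx_diag => /matrixP/(_ j j).
rewrite !mxE eqxx mulr1n => /eqP; rewrite -expr2 sqrf_eq0 subr_eq0 => /eqP.
rewrite -[RHS]expR0 => /expR_inj/eqP; rewrite mulf_eq0 (negPf wj) orbF.
by rewrite intr_eq0 => /eqP.
Qed.

(* With c the commutator of g and x, this says that g commutes with all of its
   commutators.  It singles out the fibre of the lattice because C_p^k is
   diagonalizable, hence unipotent only when it is trivial. *)
Definition commutes_with_commutators (p : {poly int}) (Gam : set G) (g : G) :=
  forall x c, Gam x -> Gam c ->
  solv_mul p g x = solv_mul p c (solv_mul p x g) ->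
  solv_mul p g c = solv_mul p c g.

(** Elements of the fibre commute with each other, and all commutators lie there. Conversely, for g
    = (k, v) and x = (0, u) the commutator is (0, (phi(k) - 1) u), and commuting with it means
    (phi(k) - 1)^2 u = 0. As such u span, phi(k) is unipotent and k = 0. *)
Lemma lattice_fibreP p Q g : (2 <= n)%N -> Delta R n p -> conjugates p Q ->
  solv_lattice Q g ->
  g.1 = 0 <-> commutes_with_commutators p (solv_lattice Q) g.
Proof.
move=> n2 Dp cQ Gg; have TG := Delta_translation_group Dp cQ.
have L := trans_law TG; have [Qu _] := cQ; split.
  move: g Gg => [r v] Gg /= r0 [s x] [t c] Gx Gc; rewrite r0.
  rewrite /solv_mul /= => -[e _]; have t0 : t = 0.
    by apply: (addIr (s + 0)); rewrite -e addr0.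
  by rewrite t0 !solv_phi0 !mul1mx [v + _]addrC.
case: (Gg) => k [v gE] P; rewrite gE /=.
suff -> : k = 0 by [].
apply: (solv_phi_unipotent n2 Dp); apply: (int_cols_inj Qu) => z.
rewrite mul0mx; set phi := solv_phi _ _ _.
pose x : G := (0, Q *m map_mx intr z).
have Gx : solv_lattice Q x by exists 0, z.
pose c := solv_mul p (solv_mul p g x) (solv_inv p (solv_mul p x g)).
have Gc : solv_lattice Q c.
  by do ?[apply: (transM TG) | apply: (transV TG)].
have e : solv_mul p g x = solv_mul p c (solv_mul p x g).
  by rewrite /c -(lawA L) (lawVl L) (law0r L).
have := P x c Gx Gc e; move: e; move: (c) => [t y].
rewrite gE /solv_mul /= => -[e1]; have -> : t = 0.
  by apply: (addIr (0 + k%:~R)); rewrite -e1 add0r addrC.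
rewrite !solv_phi0 !mul1mx => e2 [_ e3].
have -> : (phi - 1%:M) *m (phi - 1%:M) *m (Q *m map_mx intr z) =
    (phi - 1%:M) *m y.
  rewrite -mulmxA; congr (_ *m _); rewrite mulmxBl mul1mx.
  move: e2; rewrite -/phi [_ + phi *m _]addrC addrA => /addIr ->.
  by rewrite addrK.
rewrite mulmxBl mul1mx; apply/eqP; rewrite subr_eq0; apply/eqP.
by move: e3; rewrite addrC => /addIr.
Qed.

Lemma additive_int_mx m (h : 'cV[int]_N -> 'cV[R]_m) :
  {morph h : x y / x + y} ->
  exists A : 'M[R]_(m, N), forall z, h z = A *m map_mx intr z.
Proof.
move=> hD; have h0 : h 0 = 0 by apply: (addIr (h 0)); rewrite -hD !add0r.
have hS (I : finType) (F : I -> 'cV[int]_N) : h (\sum_i F i) = \sum_i h (F i).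
  exact: (big_morph h hD h0).
exists (\matrix_(i, j) h (delta_mx j 0) i 0) => z.
apply/matrixP => i j; rewrite [j]ord1 mxE {1}(matrix_sum_delta z) hS summxE.
apply: eq_bigr => k _; rewrite big_ord1 mxE [map_mx _ _ _ _]mxE.
rewrite -[z k 0]intz scaler_int morph_int// intz.
by rewrite -scaler_int mxE mulrC.
Qed.

(** The characterisation of the fibre is purely group theoretic, so it is transported by the
    isomorphism. *)
Lemma lattice_iso_fibre p q Qp Qq (th th' : G -> G) c : (2 <= n)%N ->
  Delta R n p -> Delta R n q -> conjugates p Qp -> conjugates q Qq ->
  (forall c, solv_lattice Qp c -> solv_lattice Qq (th c)) ->
  (forall d, solv_lattice Qq d -> solv_lattice Qp (th' d)) ->
  (forall c, solv_lattice Qp c -> th' (th c) = c) ->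
  (forall d, solv_lattice Qq d -> th (th' d) = d) ->
  (forall c c', solv_lattice Qp c -> solv_lattice Qp c' ->
     th (solv_mul p c c') = solv_mul q (th c) (th c')) ->
  solv_lattice Qp c -> c.1 = 0 -> (th c).1 = 0.
Proof.
move=> n2 Dp Dq cp cq thG th'G thK th'K thM Gc.
have TG := Delta_translation_group Dp cp.
move/(lattice_fibreP n2 Dp cp Gc) => P.
apply/(lattice_fibreP n2 Dq cq (thG c Gc)) => x d Gx Gd e.
have Gx' := th'G _ Gx; have Gd' := th'G _ Gd.
have thI a b : solv_lattice Qp a -> solv_lattice Qp b -> th a = th b -> a = b.
  by move=> Ga Gb /(congr1 th'); rewrite !thK.
have Gxc := transM TG Gx' Gc.
rewrite -(th'K d)// -!thM// (P (th' x) (th' d))//.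
apply: thI; [exact: (transM TG) | exact: (transM TG) |].
by rewrite (thM _ _ Gc Gx') (thM _ _ Gd' Gxc) (thM _ _ Gx' Gc) !th'K.
Qed.

(** On the fibre the group law is addition, so the restriction of [th] is an additive map on
    Z^(4n+3), given by a matrix. *)
Lemma lattice_iso_linear p q Qp Qq (th th' : G -> G) : (2 <= n)%N ->
  Delta R n p -> Delta R n q -> conjugates p Qp -> conjugates q Qq ->
  (forall c, solv_lattice Qp c -> solv_lattice Qq (th c)) ->
  (forall d, solv_lattice Qq d -> solv_lattice Qp (th' d)) ->
  (forall c, solv_lattice Qp c -> th' (th c) = c) ->
  (forall d, solv_lattice Qq d -> th (th' d) = d) ->
  (forall c c', solv_lattice Qp c -> solv_lattice Qp c' ->
     th (solv_mul p c c') = solv_mul q (th c) (th c')) ->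
  exists A : 'M[R]_N, forall v,
    solv_lattice Qp (0, v) -> th (0, v) = (0, A *m v).
Proof.
move=> n2 Dp Dq cp cq thG th'G thK th'K thM; have [Qpu _] := cp.
pose g (z : 'cV[int]_N) : G := (0, Qp *m map_mx intr z).
have Gg z : solv_lattice Qp (g z) by exists 0, z.
have th1 z : (th (g z)).1 = 0.
  exact: (lattice_iso_fibre n2 Dp Dq cp cq thG th'G thK th'K thM).
have gD z w : g (z + w) = solv_mul p (g z) (g w).
  by rewrite /g solv_mul0 map_mxD mulmxDr.
have [|A hA] := @additive_int_mx _ (fun z => (th (g z)).2).
  by move=> z w; rewrite gD thM// /solv_mul /= th1 solv_phi0 mul1mx.
exists (A *m invmx Qp) => v [k [z [_ ->]]].
rewrite -/(g z) -mulmxA (mulKmx Qpu) -(hA z).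
by have := th1 z; case: (th (g z)) => a b /= ->.
Qed.

Lemma lattice_iso_intertwine p q Qp Qq (th th' : G -> G) : (2 <= n)%N ->
  Delta R n p -> Delta R n q -> conjugates p Qp -> conjugates q Qq ->
  (forall c, solv_lattice Qp c -> solv_lattice Qq (th c)) ->
  (forall d, solv_lattice Qq d -> solv_lattice Qp (th' d)) ->
  (forall c, solv_lattice Qp c -> th' (th c) = c) ->
  (forall d, solv_lattice Qq d -> th (th' d) = d) ->
  (forall c c', solv_lattice Qp c -> solv_lattice Qp c' ->
     th (solv_mul p c c') = solv_mul q (th c) (th c')) ->
  exists (S : 'M[R]_N) (k : int), [/\ S \in unitmx, k = 1 \/ k = -1 &
    S *m solv_phi n p 1 = solv_phi n q k%:~R *m S].
Proof.
move=> n2 Dp Dq cp cq thG th'G thK th'K thM.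
have TP := Delta_translation_group Dp cp.
have TQ := Delta_translation_group Dq cq.
have th'M d d' : solv_lattice Qq d -> solv_lattice Qq d' ->
    th' (solv_mul q d d') = solv_mul p (th' d) (th' d').
  move=> Gd Gd'; have Gt := th'G _ Gd; have Gt' := th'G _ Gd'.
  rewrite -[in LHS](th'K d)// -[in LHS](th'K d')// -thM// thK//.
  exact: (transM TP).
have [A thA] := lattice_iso_linear n2 Dp Dq cp cq thG th'G thK th'K thM.
have [B thB] := lattice_iso_linear n2 Dq Dp cq cp th'G thG th'K thK th'M.
have [Qpu _] := cp.
pose v z := Qp *m map_mx intr (z : 'cV[int]_N) : 'cV[R]_N.
have Gv z : solv_lattice Qp (0, v z) by exists 0, z.
have BA : B *m A = 1%:M.
  apply: (int_cols_inj Qpu) => z; rewrite -/(v z) mul1mx -mulmxA.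
  have := thK _ (Gv z); rewrite thA// thB => [[]//|].
  by rewrite -thA//; apply: thG.
have [_ Au] := mulmx1_unit BA.
(* These elements form a complement of the fibre in the lattice. *)
pose s (m : int) : G := (m%:~R, 0).
have Gs m : solv_lattice Qp (s m) by exists m, 0; rewrite map_mx0 mulmx0.
have sD m l : s (m + l) = solv_mul p (s m) (s l).
  by rewrite /s /solv_mul /= intrD mulmx0 addr0.
have [k [w sE]] := thG _ (Gs 1).
move: (Qq *m map_mx intr w) sE => {}w sE.
have s1 m : (th (s m)).1 = (k * m)%:~R.
  have := @morph_int _ _ (fun m => (th (s m)).1) m 1.
  rewrite -[1 *~ m]/(m%:~R) intz => ->; last by move=> a b; rewrite sD thM.
  by rewrite sE /= -mulrzA.
exists A, k; split=> //.
  (* Surjectivity of [th] yields an image with first coordinate 1, so [k] divides 1. *)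
  have G1 : solv_lattice Qq (1, 0) by exists 1, 0; rewrite map_mx0 mulmx0.
  have [l [z tE]] := th'G _ G1.
  have : th (solv_mul p (0, v z) (s l)) = (1, 0).
    rewrite -(th'K _ G1) tE; congr th.
    by rewrite /solv_mul /= add0r mulmx0 addr0.
  rewrite thM// thA// => /(congr1 fst) /=; rewrite add0r s1.
  move/eqP; rewrite -[1 in X in X -> _]/(1%:~R) eqr_int => /eqP kl.
  have : k \is a GRing.unit by apply/unitrP; exists l; rewrite mulrC kl.
  by case/orP => /eqP; [left|right].
apply: (int_cols_inj Qpu) => z; rewrite -/(v z) -!mulmxA.
have Gvs : solv_lattice Qp (0, solv_phi n p 1 *m v z).
  rewrite /v mulmxA conjugates_mul// -mulmxA -map_mxM.
  by exists 0, (dsum4 1%:M (companion n p) *m z).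
(* Conjugation by [s 1] acts on the fibre as phi_p(1). Applying [th] and cancelling the second
   coordinate of [th (s 1)] gives the intertwining relation. *)
have : solv_mul p (s 1) (0, v z) = solv_mul p (0, solv_phi n p 1 *m v z) (s 1).
  by rewrite /solv_mul /s /= addr0 add0r add0r mulmx0 addr0.
move/(congr1 th); rewrite !thM// sE !thA// solv_mul0 => -[] _ /=.
rewrite [RHS]addrC; move/addrI; exact: esym.
Qed.

End LatticeIsomorphism.

(** * Classification by characteristic polynomials *)

Theorem theorem7p6 (R : realType) (n : nat) (p q : {poly int})
    (Qp Qq : 'M[R]_(solv_dim n)) :
  (2 <= n)%N -> Delta R n p -> Delta R n q ->
  conjugates p Qp -> conjugates q Qq ->
  diffeomorphic (solvmanifold p Qp) (solvmanifold q Qq) <->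
  q = p \/ q = star n p.
Proof.
move=> n2 Dp Dq cp cq; split; last first.
  case=> e; subst q; first exact: diffeomorphic_eq.
  exact: diffeomorphic_star.
move/(diffeomorphic_deck_iso (Delta_translation_group Dp cp)
  (Delta_translation_group Dq cq)) => [th [th' [thG th'G thK th'K thM]]].
have [S [k [Su k1 SE]]] :=
  lattice_iso_intertwine n2 Dp Dq cp cq thG th'G thK th'K thM.
have E : char_poly (solv_phi n p 1) = char_poly (solv_phi n q k%:~R)
  :> {poly R}.
  exact: char_poly_intertwine Su SE.
have [mp sp srp rp _] := Dp; have [mq sq srq rq _] := Dq.
have c0 : ('X - 1%:P) ^+ 3 != 0 :> {poly R}.
  exact: expf_neq0 (monic_neq0 (monicXsubC _)).
have {E} := etrans (etrans (esym (char_poly_solv_phi 1 srp)) E)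
  (char_poly_solv_phi k%:~R srq).
rewrite (map_expR_ln Dp).
(* Integer polynomials are compared over the reals, where they split. *)
have inj := map_inj_poly (@intr_inj R) (rmorph0 _).
have up := @uniq_real_roots R p; have uq := @uniq_real_roots R q.
case: k1 => -> {SE}.
  rewrite (map_expR_ln Dq) => /(prod_exp_inj (m := 4) isT c0 up uq) e; left.
  by apply: inj; rewrite (Delta_prod Dp) (Delta_prod Dq).
have ui : uniq [seq r^-1 | r <- @real_roots R q].
  by rewrite map_inj_uniq //; exact: invr_inj.
rewrite (map_expRN_ln Dq) => /(prod_exp_inj (m := 4) isT c0 up ui) e; right.
(* The roots of [p] are the inverses of those of [q], so [p] is [star n q]; since [star] is an
   involution on these polynomials, this suffices. *)
rewrite -(starK sq); congr star; apply: inj.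
by rewrite (star_prod Dq) (Delta_prod Dp).
Qed.
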